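(* Suppose $\Lambda(X)=1$ and $\Lambda=\sum_{i\in\mathcal I}\lambda_i\Lambda_i$ on $\mathcal B$, where $\mathcal I$ is an at most countable set, $(\Lambda_i)_{i\in\mathcal I}$ is a family of distinct ergodic probability measures on $\mathcal B$, and $(\lambda_i)_{i\in\mathcal I}\subset(0,1]$. For each $i\in\mathcal I$ let $Z_i$ be a measurable version of the Radon-Nikodym derivative $d\Lambda_i/d\phi_0$ (on $\mathcal A_0$), let $m_i$ be the $\Lambda_i$-essential infimum and $M_i$ the $\Lambda_i$-essential supremum of $Z_i$. Let $Q\in\mathcal B$. (a) Let $0<\alpha<1$, or let $\alpha=0$ if $[0,1]\ni x\mapsto\mathcal H_x(\Lambda,\phi_0)(Q)$ is continuous at $0$. (a)(i) If $\beta\in(0,1]\cup(1,\beta(\Lambda|\phi_0))$, then $$\mathcal H^{\beta,\alpha}(\Lambda,\phi_0)(Q)=\sum_{i\in\mathcal I}\lambda_i^\beta M_i^{\beta-1}\Lambda_i(Q).$$ The equality is also true for $\beta=0$ if also $\phi_0\ll\Lambda$. (a)(ii) If $\beta(\Lambda|\phi_0)\le\beta<\gamma(\Lambda|\phi_0)$ is such that $$\limsup_{L\to\infty}\Big(\sum_{i\in\mathcal I,\ \lambda_iM_i\le L}\lambda_i^\beta M_i^{\beta-1}+L^{\beta-1}\sum_{i\in\mathcal I,\ \lambda_iM_i>L}\lambda_i\Big)=\infty,$$ then $\mathcal H^{\beta,\alpha}(\Lambda,\phi_0)(X)=\infty$ (in the case $\alpha=0$, the continuity at $0$ being assumed for $Q=X$).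 (b) Let $1<\alpha<\gamma(\Lambda|\phi_0)$. (b)(i) If $0<\beta\le\alpha(\Lambda|\phi_0)$, or ($\beta=0$ and $\phi_0\ll\Lambda$), is such that $$\limsup_{\delta\to0}\Big(\frac1\delta\Big)^{1-\beta}\sum_{i\in\mathcal I,\ \lambda_im_i<\delta}\lambda_i=\infty,$$ then $\mathcal H^{\beta,\alpha}(\Lambda,\phi_0)(X)=\infty$. (b)(ii) If $\alpha(\Lambda|\phi_0)<\beta<\gamma(\Lambda|\phi_0)$, then $$\mathcal H^{\beta,\alpha}(\Lambda,\phi_0)(Q)=\sum_{i\in\mathcal I}\lambda_i^\beta m_i^{\beta-1}\Lambda_i(Q).$$
   Context: Setting. Let $X$ be a set, $S:X\to X$ a bijection, $\mathcal A$ a $\sigma$-algebra on $X$, $\mathcal A_0$ the $\sigma$-algebra generated by $\bigcup_{i\ge 0}S^{-i}\mathcal A$, $\mathcal B$ the $\sigma$-algebra generated by $\bigcup_{i\in\mathbb Z}S^{-i}\mathcal A$, and $\mathcal A_m:=S^{-m}\mathcal A_0=\{S^{-m}A:A\in\mathcal A_0\}$ for integers $m\le 0$ (so $\mathcal A_0\subset\mathcal A_{-1}\subset\cdots$). Let $\phi_0$ be a finite positive measure on $\mathcal A_0$, and $\Lambda$ a finite positive measure on $\mathcal A_0$ with $\Lambda\circ S^{-1}=\Lambda$ and $\Lambda\ll\phi_0$; let $Z\ge0$ be an $\mathcal A_0$-measurable version of $d\Lambda/d\phi_0$. For $Q\subset X$ let $\mathcal C(Q)$ be the set of all sequences $(A_m)_{m\le0}$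 with $A_m\in\mathcal A_m$ for all $m\le 0$ and $Q\subset\bigcup_{m\le0}A_m$. The symbol $\Lambda$ also denotes the unique $S$-invariant measure on $\mathcal B$ extending $\Lambda$. ''Ergodic'' means $S$-invariant and ergodic with respect to $S$. Conventions: extended real numbers are used; $0^0:=1$; $1/\infty:=0$; $0^x=\infty$ for $x<0$; $\infty^x=0$ for $x<0$, $\infty^0=1$, $\infty^x=\infty$ for $x>0$ (i.e. for $\beta\le1$, $M_i^{\beta-1}$ is read as $(1/M_i)^{1-\beta}$). For $\alpha\ge0$ and $Q\subset X$: $\mathcal H_\alpha(\Lambda,\phi_0)(Q):=\inf_{(A_m)\in\mathcal C(Q)}\sum_{m\le0}\int_{S^mA_m}Z^\alpha d\phi_0$. If $\mathcal H_\alpha(\Lambda,\phi_0)(Q)<\infty$, then for $\epsilon>0$ let $\mathcal C^\alpha_\epsilon(Q):=\{(A_m)\in\mathcal C(Q):\sum_{m\le0}\int_{S^mA_m}Z^\alpha d\phi_0<\mathcal H_\alpha(\Lambda,\phi_0)(Q)+\epsilon\}$, and for $\beta\ge0$ let $\mathcal H^{\beta,\alpha}(\Lambda,\phi_0)(Q):=\lim_{\epsilon\to0}\inf_{(A_m)\in\mathcal C^\alpha_\epsilon(Q)}\sum_{m\le0}\int_{S^mA_m}Z^\beta d\phi_0\in[0,\infty]$. Critical exponents: $\alpha(\Lambda|\phi_0):=\inf\{0<\beta\le1:\ \sum_{i\in\mathcal I}\lambda_i^\beta m_i^{\beta-1}<\infty\}$, $\beta(\Lambda|\phi_0):=\sup\{\beta\ge1:\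 \sum_{i\in\mathcal I}\lambda_i^\beta M_i^{\beta-1}<\infty\}$, $\gamma(\Lambda|\phi_0):=\sup\{\beta\ge1:\ \int Z^{\beta-1}d\Lambda<\infty\}$. *)

(* Defs.v *)
From HB Require Import structures.
From mathcomp Require Export all_boot all_order all_algebra.
From mathcomp Require Export all_classical all_reals all_analysis.
From mathcomp Require Export measurable_realfun ess_sup_inf.
Export Order.TTheory GRing.Theory Num.Theory.
Export numFieldNormedType.Exports.

Set Implicit Arguments.
Unset Strict Implicit.
Unset Printing Implicit Defensive.

Local Open Scope classical_set_scope.
Local Open Scope ring_scope.
Local Open Scope ereal_scope.

(* S^k A; for bijective S, preimages of iterates give the negative powers. *)
Definition spow (X : Type) (S : X -> X) (k : int) (A : set X) : set X :=
  match k with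
  | Posz n => iter n S @` A
  | Negz n => iter n.+1 S @^-1` A
  end.

(* The sigma-algebra called \mathcal A in the mathematics is the structural
   one of X; the larger ones live on aliases of the carrier of X. *)
Definition gen_future d (X : measurableType d) (S : X -> X) : set (set X) :=
  \bigcup_(i in [set: nat]) [set spow S (- i%:Z)%R A | A in @measurable d X].

Definition gen_all d (X : measurableType d) (S : X -> X) : set (set X) :=
  \bigcup_(i in [set: int]) [set spow S (- i)%R A | A in @measurable d X].

(* X with \mathcal A_0, resp. with \mathcal B *)
Notation future S := (g_sigma_algebraType (gen_future S)).
Notation two_sided S := (g_sigma_algebraType (gen_all S)).

Definition invariant_measure d (T : measurableType d) (R : realType)
    (S : T -> T) (mu : set T -> \bar R) : Prop :=
  forall A, measurable A -> mu (S @^-1` A) = mu A.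

Definition ergodic_measure d (T : measurableType d) (R : realType)
    (S : T -> T) (mu : set T -> \bar R) : Prop :=
  invariant_measure S mu /\
  forall A, measurable A -> S @^-1` A = A -> mu A = 0 \/ mu (~` A) = 0.

(* f is a version of the Radon-Nikodym derivative of nu with respect to mu.
   The values of f may be infinite (on a null set). *)
Definition RN_version d (T : measurableType d) (R : realType)
    (nu : set T -> \bar R) (mu : {measure set T -> \bar R})
    (f : T -> \bar R) : Prop :=
  measurable_fun [set: T] f /\
  forall A, measurable A -> nu A = \int[mu]_(x in A) f x.

(* Powers of x in [0, +oo] with the conventions 0^r = +oo and (+oo)^r = 0
   for r < 0; the library's powR and poweR make other choices there.
   Note that inve 0 = +oo and inve +oo = 0. *)
Definition epow (R : realType) (x : \bar R) (r : R) : \bar R :=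
  if (r < 0)%R then (inve x) `^ (- r)%R else x `^ r.

Section Hausdorff.
Context d (X : measurableType d) (R : realType) (S : X -> X).
Variables (phi : {finite_measure set (future S) -> \bar R}) (Z : X -> \bar R).

(* Sequences (A_m)_{m <= 0} are indexed by n = - m : nat, so that
   A n belongs to \mathcal A_{-n} = S^n \mathcal A_0. *)
Definition covers (Q : set X) : set (nat -> set X) :=
  [set A | (forall n, [set spow S n%:Z B | B in @measurable _ (future S)] (A n))
           /\ Q `<=` \bigcup_n A n].

Definition cover_sum (a : R) (A : nat -> set X) : \bar R :=
  \sum_(n <oo) \int[phi]_(x in spow S (- n%:Z)%R (A n)) (Z x `^ a).

Definition Hmeas (a : R) (Q : set X) : \bar R :=
  ereal_inf [set cover_sum a A | A in covers Q].

Definition covers_eps (a eps : R) (Q : set X) : set (nat -> set X) :=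
  [set A | covers Q A /\ cover_sum a A < Hmeas a Q + eps%:E].

(* Only meant for Hmeas a Q < +oo. *)
Definition Hmeas2 (b a : R) (Q : set X) : \bar R :=
  lim (ereal_inf [set cover_sum b A | A in covers_eps a eps Q]
         @[eps --> 0%R^'+]).

(* [0, 1] \ni x |-> Hmeas x Q is continuous at 0 *)
Definition Hmeas_continuous0 (Q : set X) : Prop :=
  Hmeas x Q @[x --> within `[0%R, 1%R] (nbhs (0%R : R))] --> Hmeas 0 Q.

End Hausdorff.

Section exponents.
Context (R : realType) (I : countType) (lambda : I -> R).

(* m i, M i : essential infima and suprema of the densities *)
Definition alpha_exp (m : I -> \bar R) : \bar R :=
  ereal_inf [set b%:E | b in [set b : R | (0 < b <= 1)%R /\
    \esum_(i in [set: I]) ((lambda i `^ b)%:E * epow (m i) (b - 1)) < +oo]].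

Definition beta_exp (M : I -> \bar R) : \bar R :=
  ereal_sup [set b%:E | b in [set b : R | (1 <= b)%R /\
    \esum_(i in [set: I]) ((lambda i `^ b)%:E * epow (M i) (b - 1)) < +oo]].

Definition gamma_exp d (T : measurableType d) (Lambda : {measure set T -> \bar R})
    (Z : T -> \bar R) : \bar R :=
  ereal_sup [set b%:E | b in [set b : R | (1 <= b)%R /\
    \int[Lambda]_x (Z x `^ (b - 1)) < +oo]].

End exponents.

(* Main.v *)
(** For a finite measure [psi] on [A_0], the infimum of [sum_m psi(S^m A_m)]
over the coverings of [Q] is an [S]-invariant measure of [Q], the largest
one lying below [psi] on [A_0].  For [psi = (s Z^a + t Z^b) phi0] this
measure is [sum_i lambda_i ess_inf_(Lambda_i) (s Z^(a-1) + t Z^(b-1)) Lambda_i],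
because an invariant measure below [psi] has a density with respect to
[Lambda], hence is a combination of the [Lambda_i].
The constrained infimum [H^(b,a)] then follows by Lagrange duality: lower
bounds come from [K Z^a + Z^b] with [K] large, near-optimal coverings from
[Z^a + t Z^b] with [t] small. *)

Require Import Defs.
From HB Require Import structures.
From mathcomp Require Import all_boot all_order all_algebra.
From mathcomp Require Import all_classical all_reals all_analysis.
From mathcomp Require Import measurable_realfun ess_sup_inf lra ring.
Import Order.TTheory GRing.Theory Num.Theory.
Import numFieldNormedType.Exports.

Local Open Scope classical_set_scope.
Local Open Scope ring_scope.
Local Open Scope ereal_scope.

Set Implicit Arguments.
Unset Strict Implicit.
Unset Printing Implicit Defensive.

(** The indices of a covering run over a half-line, so neither the invariance of the infimum nor its
    additivity on the two-sided sigma-algebra is visible: a covering can be moved one way but not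
    back, and its sets can be cut only along future sets. Both properties come from a supremum over
    shifts; finiteness of the total mass then returns them to the infimum itself. Absolute
    continuity and the value on each ergodic component have one source, recurrence. Where the
    density of [psi] is at most [c Z], a covering made of first visits of the backward orbit to that
    place costs at most [c Lambda], and ergodicity makes almost every orbit visit it as soon as it
    has positive measure. This has no grip on points whose whole backward orbit lies in [Z = 0].
    [Lambda] does not see them, but [Z^0 = 1] may charge them; this is where continuity at 0, or
    domination of [phi0] by [Lambda], enters. *)

(** * Iterates of a bijection: images and preimages *)

Section shift.
Context (T : Type) (S : T -> T) (S_bij : bijective S).

Lemma bijective_iter n : bijective (iter n S).
Proof. by elim: n => [|n IH] /=; [exists id|exact: bij_comp]. Qed.

Lemma preimage_iter_imageK n (A : set T) : iter n S @^-1` (iter n S @` A) = A.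
Proof.
apply/seteqP; split=> [x [y Ay]|x Ax]; last by exists x.
by move=> /(bij_inj (bijective_iter n)) <-.
Qed.

Lemma image_iter_preimageK n (A : set T) : iter n S @` (iter n S @^-1` A) = A.
Proof.
apply/seteqP; split=> [x [y Ay <-]//|x Ax].
by have [g _ fg] := bijective_iter n; exists (g x); rewrite /= fg.
Qed.

Lemma image_iterI n (A B : set T) :
  iter n S @` (A `&` B) = iter n S @` A `&` iter n S @` B.
Proof.
rewrite -[RHS](image_iter_preimageK n) preimage_setI.
by rewrite !preimage_iter_imageK.
Qed.

Lemma preimage_iterD m n (A : set T) :
  iter (m + n) S @^-1` A = iter n S @^-1` (iter m S @^-1` A).
Proof. by apply/funext => x; rewrite /preimage /= iterD. Qed.

Lemma image_iterD m n (A : set T) :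
  iter (m + n) S @` A = iter m S @` (iter n S @` A).
Proof.
by rewrite image_comp; apply: eq_imagel => x _ /=; rewrite iterD.
Qed.

Lemma preimage_image_iter m n (A : set T) :
  iter (m + n) S @^-1` (iter m S @` A) = iter n S @^-1` A.
Proof. by rewrite preimage_iterD preimage_iter_imageK. Qed.

Lemma spow_negE n (A : set T) : spow S (- n%:Z)%R A = iter n S @^-1` A.
Proof. by case: n => [|n] //=; rewrite image_id. Qed.

End shift.

(** * Shifts of future and two-sided measurable sets *)

Lemma sigma_algebra_preimage_sub (T U : Type) (f : T -> U)
    (G : set (set U)) (H : set (set T)) :
  sigma_algebra setT H -> (forall A, G A -> H (f @^-1` A)) ->
  forall A, <<s G >> A -> H (f @^-1` A).
Proof.
move=> sH GH A sGA.
have := smallest_sub (sigma_algebra_image f sH) (G := G).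
rewrite /image_set_system => /(_ _ A sGA); rewrite /= setTI; apply.
by move=> B GB /=; rewrite setTI; exact: GH.
Qed.

Section sigma_algebras.
Context d (X : measurableType d) (S : X -> X) (S_bij : bijective S).

Local Notation mF := (@measurable _ (future S)).
Local Notation mB := (@measurable _ (two_sided S)).

(** [S^-1] sends the generators [S^-i A] to [S^-(i+1) A], again generators. Images lead out of this
    sigma-algebra in general, hence the asymmetry between preimages and images in what follows. *)
Lemma future_measurable_preimage n (A : set X) : mF A -> mF (iter n S @^-1` A).
Proof.
elim: n A => [//|n IH] A mA.
rewrite -[n.+1]add1n preimage_iterD; apply: IH => /=.
apply: sigma_algebra_preimage_sub mA; first exact: sigma_algebra_measurable.
move=> _ [i _ [B mB <-]]; apply: sub_sigma_algebra; exists i.+1 => //.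
by exists B => //; rewrite !spow_negE // -[i.+1]addn1 preimage_iterD.
Qed.

Lemma future_two_sided (A : set X) : mF A -> mB A.
Proof.
apply: sub_sigma_algebra2 => _ [i _ [B mB <-]].
by exists (i%:Z) => //; exists B.
Qed.

Lemma measurable_future (A : set X) : measurable A -> mF A.
Proof.
by move=> mA; apply: sub_sigma_algebra; exists 0%N => //; exists A;
  rewrite // spow_negE.
Qed.

Lemma two_sided_measurable_preimage n (A : set X) :
  mB A -> mB (iter n S @^-1` A).
Proof.
elim: n A => [//|n IH] A mA.
rewrite -[n.+1]add1n preimage_iterD; apply: IH => /=.
apply: sigma_algebra_preimage_sub mA; first exact: sigma_algebra_measurable.
move=> _ [i _ [B mB <-]]; case: i => i.
  apply: future_two_sided; rewrite spow_negE.
  by rewrite -preimage_iterD; apply: future_measurable_preimage; exact: measurable_future.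
apply: sub_sigma_algebra; exists (- i%:Z)%R => //; exists B => //.
rewrite opprK NegzE opprK /= -(preimage_iter_imageK S_bij 1 (_ @` B)).
by rewrite -image_iterD.
Qed.

Lemma two_sided_measurable_image n (A : set X) : mB A -> mB (iter n S @` A).
Proof.
have [S' SK S'K] := S_bij.
(* Images under [S] are preimages under its inverse, so the argument on generators applies to them
   too. *)
have imS : forall B : set X, S @` B = S' @^-1` B.
  move=> B; apply/seteqP; split=> [x [y By <-]|x /= Bx]; first by rewrite /= SK.
  by exists (S' x).
elim: n => [|n IH] mA; first by rewrite image_id.
rewrite -[n.+1]add1n image_iterD /= imS.
apply: sigma_algebra_preimage_sub (IH mA).
  exact: sigma_algebra_measurable.
move=> _ [i _ [B mB <-]]; apply: sub_sigma_algebra.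
exists (i - 1)%R => //; exists B => //; rewrite -imS; case: i => [[|i]|i].
- by rewrite sub0r opprK oppr0 /= [in RHS]image_id.
- have -> : (i.+1%:Z - 1 = i%:Z)%R by rewrite intS addrC addKr.
  by rewrite !spow_negE -[i.+1]addn1 preimage_iterD (image_iter_preimageK S_bij 1).
- have -> : (- (Negz i - 1) = i.+2%:Z)%R by rewrite NegzE opprB opprK -intS.
  by rewrite NegzE opprK -[i.+2]add1n /= (image_iterD S 1).
Qed.

(** The form in which Caratheodory measurability will be checked on generators. *)
Lemma gen_all_image (A : set X) : gen_all S A ->
  exists n B, mF B /\ A = iter n S @` B.
Proof.
move=> [[n|n] _ [B mB <-]].
  exists 0%N, (iter n S @^-1` B); rewrite spow_negE image_id; split => //.
  by apply: future_measurable_preimage; exact: measurable_future.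
by exists n.+1, B; rewrite NegzE opprK; split => //; exact: measurable_future.
Qed.

End sigma_algebras.

(** * The covering outer measure of a measure on the future *)

Section outer.
Context d (X : measurableType d) (R : realType) (S : X -> X).
Context (S_bij : bijective S).

Local Notation mF := (@measurable _ (future S)).
Local Notation mB := (@measurable _ (two_sided S)).

(** A covering set [A_n = S^n B_n] is recorded by [B_n], so that every cost is a value of [psi] on a
    future set. *)
Definition future_covers (Q : set X) : set (nat -> set X) :=
  [set B | (forall n, mF (B n)) /\ Q `<=` \bigcup_n (iter n S @` B n)].

Definition future_outer (psi : set X -> \bar R) (Q : set X) : \bar R :=
  ereal_inf [set \sum_(n <oo) psi (B n) | B in future_covers Q].

Section measure.
Variable psi : {measure set (future S) -> \bar R}.
Local Notation H := (future_outer psi).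

Lemma future_outer_le_cover Q B : future_covers Q B ->
  H Q <= \sum_(n <oo) psi (B n).
Proof. by move=> QB; apply: ereal_inf_lbound; exists B. Qed.

Lemma future_outer_lt Q (x : \bar R) : H Q < x ->
  exists2 B, future_covers Q B & \sum_(n <oo) psi (B n) < x.
Proof. by move=> /ereal_inf_lt [_ [B QB <-] Bx]; exists B. Qed.

Lemma future_outer_ge0 Q : 0 <= H Q.
Proof.
by apply: le_ereal_inf_tmp => _ [B [mB _] <-]; exact: nneseries_ge0.
Qed.

Lemma le_future_outer : {homo H : A B / A `<=` B >-> A <= B}.
Proof.
move=> A B AB; apply: ereal_inf_le_tmp => _ [C [mC BC] <-].
by exists C => //; split => //; exact: subset_trans BC.
Qed.

Lemma future_outer_le_measure A : mF A -> H A <= psi A.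
Proof.
move=> mA; pose C n := if n is 0%N then A else set0.
have -> : psi A = \sum_(n <oo) psi (C n).
  rewrite nneseries_recl// eseries_cond/= eseries0 ?adde0// => -[|n]//= _ _.
apply: future_outer_le_cover; split=> [[|n]|x Ax]; [exact: mA|exact: measurable0|].
by exists 0%N => //; exists x.
Qed.

Lemma future_outer0 : H set0 = 0.
Proof.
apply/eqP; rewrite eq_le future_outer_ge0 andbT.
by rewrite (le_trans (future_outer_le_measure _))// measure0.
Qed.

(** Coverings of the [A n] are merged level by level: level [k] becomes the union over [n] of the
    [G n k], still a future set, and the double series is summed in the other order. *)
Lemma future_outer_sigma_subadditive : sigma_subadditive H.
Proof.
move=> A; have [[i ioo]|/forallNP Aoo] := pselect (exists i, H (A i) = +oo).
  rewrite (eseries_pinfty _ _ ioo) ?leey// => n _.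
  by rewrite -ltNye (lt_le_trans _ (future_outer_ge0 _)).
apply/lee_addgt0Pr => e e0.
apply: (le_trans _ (epsilon_trick _ _ (ltW e0))); last first.
  by move=> n; exact: future_outer_ge0.
have /choice[G PG] n : exists B, future_covers (A n) B /\
    \sum_(k <oo) psi (B k) < H (A n) + (e / (2 ^ n.+1)%:R)%:E.
  have [|B AB HB] := @future_outer_lt (A n) (H (A n) + (e / (2 ^ n.+1)%:R)%:E).
    rewrite lteDl ?lte_fin ?divr_gt0 ?ltr0n ?expn_gt0//.
    by rewrite ge0_fin_numE ?future_outer_ge0// ltey; apply/eqP/Aoo.
  by exists B.
have mG n k : mF (G n k) by have [[+ _] _] := PG n; apply.
apply: (@le_trans _ _ (\sum_(k <oo) psi (\bigcup_n G n k))).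
  apply: future_outer_le_cover; split => [k|x [n _ Anx]].
    exact: bigcupT_measurable.
  have [[_ /(_ x Anx) [k _ [y Gy <-]]] _] := PG n.
  by exists k => //; exists y => //; exists n.
apply: (@le_trans _ _ (\sum_(k <oo) \sum_(n <oo) psi (G n k))).
  apply: lee_nneseries => [k _ _|k _]; first exact: measure_ge0.
  by apply: measure_sigma_subadditive => //; exact: bigcupT_measurable.
rewrite nneseries_interchange//.
apply: lee_nneseries => [n _ _|n _]; first exact: nneseries_ge0.
by have [_ /ltW] := PG n.
Qed.

Definition future_outer_measure : {outer_measure set X -> \bar R} :=
  HB.pack H (isOuterMeasure.Build R X H
    future_outer0 future_outer_ge0 le_future_outer future_outer_sigma_subadditive).

Lemma future_outerIC Q A : H Q <= H (Q `&` A) + H (Q `&` ~` A).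
Proof. exact: (le_outer_measureIC future_outer_measure). Qed.

Lemma future_outerU2 A B : H (A `|` B) <= H A + H B.
Proof. exact: (outer_measureU2 future_outer_measure). Qed.

(** A covering of [S^-1 Q] moved up by one index covers [Q] at the same cost. The reverse move fails
    at index 0, so at this stage only an inequality is available. *)
Lemma future_outer_preimage1 Q : H Q <= H (S @^-1` Q).
Proof.
apply: le_ereal_inf_tmp => _ [B [mB QB] <-].
pose C n := if n is k.+1 then B k else set0.
have -> : \sum_(n <oo) psi (B n) = \sum_(n <oo) psi (C n).
  apply/esym/cvg_lim => //; rewrite -cvg_shiftS.
  under eq_fun do rewrite big_nat_recl//= measure0 add0e.
  by apply: is_cvg_nneseries => n _ _; exact: measure_ge0.
apply: future_outer_le_cover; split=> [[|n]|x Qx]; [exact: measurable0|exact: mB|].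
have [S' SK S'K] := S_bij.
have [|n _ [y By yx]] := QB (S' x); first by rewrite /= S'K.
by exists n.+1 => //; exists y => //=; rewrite yx S'K.
Qed.

Lemma le_future_outer_preimage m n Q : (m <= n)%N ->
  H (iter m S @^-1` Q) <= H (iter n S @^-1` Q).
Proof.
move=> /subnK <-; elim: (n - m)%N => [//|k IH]; apply: (le_trans IH).
rewrite addSn -(addn1 (k + m)) (preimage_iterD _ (k + m) 1).
exact: (future_outer_preimage1 (iter (k + m) S @^-1` Q)).
Qed.

(** [S^n B_n] meets [A] in [S^n (B_n & S^-n A)], and [S^-n A] is again a future set: each level of a
    covering splits inside the future. *)
Lemma future_outer_caratheodory A T : mF A -> H (T `&` A) + H (T `&` ~` A) <= H T.
Proof.
move=> mA; apply: le_ereal_inf_tmp => _ [B [mB TB] <-].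
have mnA n : mF (iter n S @^-1` A) by exact: future_measurable_preimage.
have mnAC n : mF (~` (iter n S @^-1` A)) by exact: measurableC.
have -> : \sum_(n <oo) psi (B n) =
   \sum_(n <oo) psi (B n `&` iter n S @^-1` A) +
   \sum_(n <oo) psi (B n `&` ~` (iter n S @^-1` A)).
  rewrite -nneseriesD//; apply: eq_eseriesr => n _.
  by rewrite (measureDI psi (mB n) (mnA n)) setDE addeC.
apply: leeD; apply: future_outer_le_cover.
  split=> [n|x [Tx Ax]]; first exact: measurableI.
  by have [n _ [y By yx]] := TB x Tx; exists n => //; exists y => //; split => //=; rewrite yx.
split=> [n|x [Tx Ax]]; first exact: measurableI.
by have [n _ [y By yx]] := TB x Tx; exists n => //; exists y => //; split => //=; rewrite yx.
Qed.

(* [future_outer] is not itself Caratheodory on the larger sigma-algebra, but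
   the supremum of its shifts is, and both agree on [set: X]. *)
Definition shift_outer (T : set X) : \bar R :=
  ereal_sup (range (fun k => H (iter k S @^-1` T))).

Lemma le_shift_outer_term k T : H (iter k S @^-1` T) <= shift_outer T.
Proof. by apply: ereal_sup_ubound; exists k. Qed.

Lemma shift_outer_cst T c : (forall k, H (iter k S @^-1` T) = c) ->
  shift_outer T = c.
Proof.
move=> Tc; apply/eqP; rewrite eq_le; apply/andP; split.
  by apply: ge_ereal_sup => _ [k _ <-]; rewrite Tc.
by rewrite -(Tc 0%N) le_shift_outer_term.
Qed.

Lemma shift_outer0 : shift_outer set0 = 0.
Proof. by apply: shift_outer_cst => k; rewrite preimage_set0 future_outer0. Qed.

Lemma shift_outer_ge0 T : 0 <= shift_outer T.
Proof. exact: le_trans (future_outer_ge0 _) (le_shift_outer_term 0 T). Qed.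

Lemma le_shift_outer : {homo shift_outer : A B / A `<=` B >-> A <= B}.
Proof.
move=> A B AB; apply: ge_ereal_sup => _ [k _ <-].
apply: le_trans (le_shift_outer_term k B).
by apply: le_future_outer; exact: preimage_subset.
Qed.

Lemma shift_outer_sigma_subadditive : sigma_subadditive shift_outer.
Proof.
move=> A; apply: ge_ereal_sup => _ [k _ <-]; rewrite preimage_bigcup.
apply: (le_trans (future_outer_sigma_subadditive _)).
by apply: lee_nneseries => [n _ _|n _];
  [exact: future_outer_ge0|exact: le_shift_outer_term].
Qed.

Definition shift_outer_measure : {outer_measure set X -> \bar R} :=
  HB.pack shift_outer (isOuterMeasure.Build R X shift_outer
    shift_outer0 shift_outer_ge0 le_shift_outer shift_outer_sigma_subadditive).

(** For a generator [A = S^m B] and [k >= m], [S^-k A = S^-(k-m) B] is a future set and splits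
    [S^-k T]. The shifts of [H] are nondecreasing, so their suprema are limits, and the splitting
    survives as [k] grows. *)
Lemma shift_outer_caratheodory A : mB A -> shift_outer_measure.-caratheodory A.
Proof.
have sC : sigma_algebra setT shift_outer_measure.-caratheodory.
  split; first exact: caratheodory_measurable_set0.
    by move=> B cB; rewrite setTD; exact: caratheodory_measurable_setC.
  exact: caratheodory_measurable_bigcup.
apply: (smallest_sub sC) => {}A /gen_all_image [m [B [mB ->]]].
apply: le_caratheodory_measurable => T.
pose a k := H (iter k S @^-1` (T `&` iter m S @` B)).
pose b k := H (iter k S @^-1` (T `&` ~` (iter m S @` B))).
have nda : nondecreasing_seq a by move=> j k; exact: le_future_outer_preimage.
have ndb : nondecreasing_seq b by move=> j k; exact: le_future_outer_preimage.
have b0 k : 0 <= b k by exact: future_outer_ge0.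
have sb0 : 0 <= ereal_sup (range b).
  by apply: le_trans (b0 0%N) _; apply: ereal_sup_ubound; exists 0%N.
have ab : a k + b k @[k --> \oo] --> ereal_sup (range a) + ereal_sup (range b).
  apply: cvgeD; [|exact: ereal_nondecreasing_cvgn..].
  by rewrite ge0_adde_def ?inE//; exact: shift_outer_ge0.
rewrite [leLHS](_ : _ = ereal_sup (range a) + ereal_sup (range b))//.
rewrite -(cvg_lim _ ab)//; apply: lime_le; first by apply/cvg_ex; eexists; exact: ab.
near=> k; have mk : (m <= k)%N by near: k; exact: nbhs_infty_ge.
apply: le_trans (le_shift_outer_term k T).
have eB : iter k S @^-1` (iter m S @` B) = iter (k - m) S @^-1` B.
  by rewrite -{1}(subnKC mk) preimage_image_iter.
have := @future_outer_caratheodory (iter (k - m) S @^-1` B) (iter k S @^-1` T).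
by rewrite -eB; apply; rewrite eB; exact: future_measurable_preimage.
Unshelve. all: by end_near. Qed.

Section finite.
Hypothesis psi_fin : psi setT < +oo.

Lemma future_outer_fin_num A : H A \is a fin_num.
Proof.
rewrite ge0_fin_numE ?future_outer_ge0//; apply: le_lt_trans psi_fin.
apply: le_trans (future_outer_le_measure measurableT).
exact: le_future_outer.
Qed.

(** [H] lies below [shift_outer] and agrees with it on the whole space; [H] is subadditive and
    [shift_outer] additive across [A]. Masses being finite, a gap at [A] would show in the total. *)
Lemma shift_outerE A : mB A -> shift_outer A = H A.
Proof.
move=> mA; have := shift_outer_caratheodory mA setT.
rewrite /= !setTI => E.
have le0 T : H T <= shift_outer T by have := le_shift_outer_term 0 T.
have sT : shift_outer setT = H setT.
  exact: shift_outer_cst.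
have fin T : shift_outer T \is a fin_num.
  rewrite ge0_fin_numE ?shift_outer_ge0//.
  apply: le_lt_trans (le_shift_outer (@subsetT _ T)) _.
  by rewrite sT -ge0_fin_numE ?future_outer_ge0 ?future_outer_fin_num.
apply/eqP; rewrite eq_le le0 andbT.
rewrite -(leeD2rE _ _ (fin (~` A))) -E sT.
apply: le_trans (future_outerIC setT A) _; rewrite !setTI.
by apply: leeD => //; exact: le0.
Qed.

(** A nondecreasing sequence whose supremum is its first term is constant. *)
Lemma future_outer_preimage A n : mB A -> H (iter n S @^-1` A) = H A.
Proof.
move=> mA; apply/eqP; rewrite eq_le (@le_future_outer_preimage 0 n)// andbT.
by rewrite -(shift_outerE mA); exact: le_shift_outer_term.
Qed.

Lemma future_outerID Q A : mB Q -> mB A ->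
  H Q = H (Q `&` A) + H (Q `&` ~` A).
Proof.
move=> mQ mA; rewrite -!shift_outerE//; last 2 first.
- by apply: measurableI => //; exact: measurableC.
- exact: measurableI.
exact: shift_outer_caratheodory.
Qed.

End finite.
End measure.
End outer.

(** * Hahn sets of two invariant measures *)

Section hahn_invariant.
Context d (T : measurableType d) (R : realType).
Implicit Types (m : {finite_measure set T -> \bar R}) (A B U : set T).

Definition measure_le_on m1 m2 U :=
  forall A, measurable A -> A `<=` U -> m1 A <= m2 A.

Lemma measure_le_on_bigcup m1 m2 (U : nat -> set T) :
  (forall n, measurable (U n)) -> (forall n, measure_le_on m1 m2 (U n)) ->
  measure_le_on m1 m2 (\bigcup_n U n).
Proof.
move=> mU le_U A mA AU.
have mD n : measurable (A `&` seqDU U n).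
  by apply: measurableI => //; apply: measurableD => //; exact: bigsetU_measurable.
have mE m : m A = \sum_(n <oo) m (A `&` seqDU U n).
  rewrite -measure_semi_bigcup//.
  - by rewrite -setI_bigcupr -seqDU_bigcup_eq setIidl.
  - by apply: trivIset_setIl; exact: trivIset_seqDU.
  - by apply: bigcupT_measurable.
rewrite !mE; apply: lee_nneseries => [n _ _|n _]; first exact: measure_ge0.
by apply: (le_U n) => // x [_ []].
Qed.

Let mDI m A B : measurable A -> measurable B -> m A = m (A `\` B) + m (A `&` B).
Proof. exact: measureDI. Qed.

Let mU m A B : measurable A -> measurable B -> A `&` B = set0 ->
  m (A `|` B) = m A + m B.
Proof. exact: measureU. Qed.

Let fm m A : measurable A -> m A = (fine (m A))%:E.
Proof. by move=> mA; rewrite fineK// fin_num_measure. Qed.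

Lemma exists_hahn m1 m2 : exists2 P, measurable P &
  measure_le_on m2 m1 P /\ measure_le_on m1 m2 (~` P).
Proof.
pose nu : {charge set T -> \bar R} := cadd (charge_of_finite_measure m1)
  (copp (charge_of_finite_measure m2)).
have nuE A : nu A = m1 A - m2 A by [].
have [P [N [[mP P0] [mN N0] PN1 PN0]]] := Hahn_decomposition nu.
exists P => //; split => A mA AP.
  by have := P0 A mA AP; rewrite nuE sube_ge0// fin_num_measure.
have := N0 A mA; rewrite nuE sube_le0; apply.
by move=> x /AP nPx; have [] : (P `|` N) x by rewrite PN1.
Qed.

(** A Hahn set maximizes [m1 - m2]; the difference is written additively to stay within nonnegative
    extended reals. *)
Lemma measure_le_on_max m1 m2 P B : measurable P -> measurable B ->
  measure_le_on m2 m1 P -> measure_le_on m1 m2 (~` P) ->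
  m1 B + m2 P <= m1 P + m2 B.
Proof.
move=> mP mB P1 P2.
have h1 := P1 (P `\` B) (measurableD mP mB) (@subDsetl _ _ _).
have h2 := P2 (B `\` P) (measurableD mB mP) (fun x => @proj2 _ _).
rewrite (mDI m1 mB mP) (mDI m1 mP mB).
rewrite (mDI m2 mB mP) (mDI m2 mP mB) (setIC B P).
have mPB := measurableD mP mB; have mBP := measurableD mB mP.
have mPIB := measurableI _ _ mP mB.
move: h1 h2; rewrite (fm m1 mPB) (fm m2 mPB) (fm m1 mBP) (fm m2 mBP).
rewrite (fm m1 mPIB) (fm m2 mPIB) -!EFinD !lee_fin; lra.
Qed.

(** At a maximizer, deleting a subset [A] of [P] or adding an [A] disjoint from [P] cannot increase
    [m1 - m2]. *)
Lemma max_measure_le_on m1 m2 P : measurable P ->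
  (forall B, measurable B -> m1 B + m2 P <= m1 P + m2 B) ->
  measure_le_on m2 m1 P /\ measure_le_on m1 m2 (~` P).
Proof.
move=> mP maxP.
split=> A mA AP.
  have mPA := measurableD mP mA.
  have := maxP _ mPA; rewrite (mDI m1 mP mA) (mDI m2 mP mA).
  rewrite (setIidr AP) (fm m1 mPA) (fm m2 mPA) (fm m1 mA) (fm m2 mA).
  rewrite -!EFinD !lee_fin; lra.
have PA0 : P `&` A = set0 by rewrite setIC; apply/disjoints_subset.
have := maxP _ (measurableU _ _ mP mA).
rewrite !mU// (fm m1 mP) (fm m2 mP) (fm m1 mA) (fm m2 mA).
by rewrite -!EFinD !lee_fin; lra.
Qed.

(* The Hahn set of m1 - m2 maximizes m1 - m2, hence so do its preimages; their
   upper limit is a Hahn set which is moreover strictly invariant. *)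
Lemma exists_hahn_invariant (S : T -> T) m1 m2 :
  (forall A, measurable A -> measurable (S @^-1` A)) ->
  invariant_measure S m1 -> invariant_measure S m2 ->
  exists2 W, measurable W & [/\ S @^-1` W = W,
    measure_le_on m2 m1 W & measure_le_on m1 m2 (~` W)].
Proof.
move=> mS inv1 inv2; have [P mP [P1 P2]] := exists_hahn m1 m2.
pose F n := iter n (preimage S) P.
have mF n : measurable (F n) by elim: n => //= n; exact: mS.
have hF n : measure_le_on m2 m1 (F n) /\ measure_le_on m1 m2 (~` F n).
  apply: max_measure_le_on => // B mB.
  have -> : m1 (F n) = m1 P by elim: n => //= n; rewrite inv1.
  have -> : m2 (F n) = m2 P by elim: n => //= n; rewrite inv2.
  exact: measure_le_on_max.
have mW : measurable (lim_sup_set F).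
  by apply: bigcap_measurable => // n _; exact: bigcup_measurable.
exists (lim_sup_set F) => //; split.
- apply/seteqP; split=> [x Wx n _|x Wx n _].
    by have [j nj Fx] := Wx n I; exists j.+1 => //=; exact: leq_trans nj _.
  by have [[//|j] nj Fx] := Wx n.+1 I; exists j.
- move=> A mA AW; apply: (measure_le_on_bigcup mF) => //.
    by move=> n; have [] := hF n.
  by move=> x /AW /(_ 0%N I) [j _ Fx]; exists j.
- move=> A mA AW.
  apply: (@measure_le_on_bigcup m1 m2 (fun n => ~` F n)) => //.
    by move=> n; exact: measurableC.
    by move=> n; have [] := hF n.
  move=> x /AW Wx; apply: contrapT => nF; apply: Wx => n _; exists n => //=.
  by apply: contrapT => Fx; apply: nF; exists n.
Qed.

End hahn_invariant.

(** * Invariant measures, the outer measure and recurrence *)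

Section invariant.
Context d (X : measurableType d) (R : realType) (S : X -> X).
Context (S_bij : bijective S).

Local Notation measF := (@measurable _ (future S)).
Local Notation measB := (@measurable _ (two_sided S)).
Local Notation H psi := (future_outer S psi).
Implicit Types (psi : {measure set (future S) -> \bar R}).
Implicit Types (rho : {measure set (two_sided S) -> \bar R}) (A D Q : set X).

Lemma invariant_preimage_iter rho n A :
  invariant_measure (S : two_sided S -> two_sided S) rho -> measB A ->
  rho (iter n S @^-1` A) = rho A.
Proof.
move=> inv; elim: n A => [//|n IH] A mA.
rewrite -addn1 preimage_iterD -(IH A mA); apply: inv.
exact: two_sided_measurable_preimage.
Qed.

Lemma invariant_image_iter rho n A :
  invariant_measure (S : two_sided S -> two_sided S) rho -> measB A ->
  rho (iter n S @` A) = rho A.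
Proof.
move=> inv mA; rewrite -(invariant_preimage_iter n inv).
  by rewrite preimage_iter_imageK.
exact: two_sided_measurable_image.
Qed.

Lemma le_future_outer_image psi n Q : H psi (iter n S @` Q) <= H psi Q.
Proof.
rewrite -[in leRHS](preimage_iter_imageK S_bij n Q).
exact: (le_future_outer_preimage S_bij psi _ (leq0n n)).
Qed.

(** Invariance replaces [S^n B_n] by the future set [B_n], where the comparison with [psi] is
    available. *)
Lemma invariant_le_outer psi rho Q :
  invariant_measure (S : two_sided S -> two_sided S) rho ->
  (forall A, measF A -> rho A <= psi A) -> measB Q -> rho Q <= H psi Q.
Proof.
move=> inv le_psi mQ; apply: le_ereal_inf_tmp => _ [B [mB QB] <-].
have mSB n : measB (iter n S @` B n).
  by apply: two_sided_measurable_image => //; exact: future_two_sided.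
apply: (@le_trans _ _ (\sum_(n <oo) rho (iter n S @` B n))).
  by apply: measure_sigma_subadditive.
apply: lee_nneseries => [n _ _|n _]; first exact: measure_ge0.
rewrite invariant_image_iter//; first exact: le_psi.
exact: future_two_sided.
Qed.

(** The upper bound is the lower bound on the complement, as [rho] and [psi] have equal total mass.
    Two consequences are used: coverings nearly optimal for [rho] exist, and a finite invariant
    measure is determined by its values on the future. *)
Lemma outer_invariantE psi rho Q :
  invariant_measure (S : two_sided S -> two_sided S) rho ->
  (forall A, measF A -> rho A = psi A) -> psi setT < +oo ->
  measB Q -> H psi Q = rho Q.
Proof.
move=> inv eq_psi fin mQ.
have le Q' : measB Q' -> rho Q' <= H psi Q'.
  by apply: invariant_le_outer => // A mA; rewrite eq_psi.
have ffin Q' : H psi Q' \is a fin_num by exact: future_outer_fin_num.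
have mQC : measB (~` Q) by exact: measurableC.
apply/eqP; rewrite eq_le le// andbT.
have rfin : rho (~` Q) \is a fin_num.
  rewrite ge0_fin_numE//; apply: le_lt_trans (le _ mQC) _.
  by rewrite -ge0_fin_numE ?future_outer_ge0.
rewrite -(leeD2rE _ _ rfin).
have -> : rho Q + rho (~` Q) = psi setT.
  rewrite -measureU//; first by rewrite setUv; exact: eq_psi.
  by rewrite setICr.
apply: (@le_trans _ _ (H psi Q + H psi (~` Q))); first by rewrite leeD2l// le.
have := @future_outerID _ _ _ _ S_bij psi fin setT Q measurableT mQ.
by rewrite !setTI => <-; exact: future_outer_le_measure.
Qed.

(** The same set function under a second name, to carry a measure structure over the smaller
    sigma-algebra. *)
Definition restr_future (rho : set (two_sided S) -> \bar R) :
  set (future S) -> \bar R := rho.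

Section restr.
Variable rho : {measure set (two_sided S) -> \bar R}.

Let restr0 : restr_future rho set0 = 0. Proof. exact: measure0. Qed.

Let restr_ge0 A : 0 <= restr_future rho A. Proof. exact: measure_ge0. Qed.

Let restr_sigma_additive : semi_sigma_additive (restr_future rho).
Proof.
move=> F mF tF mUF; apply: measure_semi_sigma_additive => //.
- by move=> n; exact: future_two_sided.
- exact: future_two_sided.
Qed.

HB.instance Definition _ := isMeasure.Build _ (future S) R (restr_future rho)
  restr0 restr_ge0 restr_sigma_additive.
End restr.

Section restr_fin.
Variable rho : probability (two_sided S) R.

Let restr_fin : fin_num_fun (restr_future rho).
Proof. by move=> A mA; apply: fin_num_measure; exact: future_two_sided. Qed.

HB.instance Definition _ := Measure_isFinite.Build _ (future S) R
  (restr_future rho) restr_fin.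
End restr_fin.

(* points whose backward orbit visits D infinitely often *)
Definition past_limsup D := lim_sup_set (fun n => iter n S @` D).

Lemma measurable_past_limsup D : measB D -> measB (past_limsup D).
Proof.
move=> mD; apply: bigcap_measurable => // n _.
by apply: bigcup_measurable => k _; exact: two_sided_measurable_image.
Qed.

Lemma past_limsup_preimage D : S @^-1` past_limsup D = past_limsup D.
Proof.
apply/seteqP; split=> [x Dx n _|x Dx n _].
  (* A visit at time at least [n.+1] cannot be at time 0, so it can be moved back by one. *)
  have [[|k] nk [y Dy yx]] := Dx n.+1 I; first by [].
  exists k => //; exists y => //; apply: (bij_inj S_bij); exact: yx.
have [k nk [y Dy yx]] := Dx n I; exists k.+1; first exact: leqW.
by exists y => //=; rewrite yx.
Qed.

Lemma past_limsup_preimage_iter D n :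
  iter n S @^-1` past_limsup D = past_limsup D.
Proof.
elim: n => // n IH; rewrite -addn1 preimage_iterD IH.
exact: past_limsup_preimage.
Qed.

(* Poincare recurrence: the tails of the union of the S^n D are images of each
   other, hence have the same mass. *)
Lemma future_outer_recurrence psi D : psi setT < +oo -> measB D ->
  H psi (D `\` past_limsup D) = 0.
Proof.
move=> fin mD; pose U n := \bigcup_(k >= n) (iter k S @` D).
have mU n : measB (U n).
  by apply: bigcup_measurable => k _; exact: two_sided_measurable_image.
have HU n : H psi (U n) = H psi (U 0%N).
  rewrite -(future_outer_preimage S_bij fin n (mU n)); congr (H psi).
  apply/seteqP; split=> [x [k nk [y Dy yx]]|x [k _ [y Dy yx]]].
    exists (k - n)%N => //; exists y => //; apply: (bij_inj (bijective_iter S_bij n)).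
    by rewrite -iterD subnKC.
  by exists (n + k)%N; [exact: leq_addr|exists y => //; rewrite iterD yx].
have ffin Q' : H psi Q' \is a fin_num by exact: future_outer_fin_num.
have U0 n : H psi (U 0%N `&` ~` U n) = 0.
  have := future_outerID S_bij fin (mU 0%N) (mU n).
  rewrite (_ : U 0%N `&` U n = U n); last first.
    by rewrite setIidr// => x [k _ ?]; exists k.
  rewrite (HU n) -(fineK (ffin (U 0%N))) -(fineK (ffin (U 0%N `&` ~` U n))) -EFinD.
  by move=> [] /eqP; rewrite -subr_eq0 opprD addNKr oppr_eq0 => /eqP ->.
apply/eqP; rewrite eq_le future_outer_ge0 andbT.
apply: (@le_trans _ _ (H psi (\bigcup_n (U 0%N `&` ~` U n)))).
  apply: le_future_outer => x [Dx /existsNP [n /not_implyP [_ nU]]].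
  by exists n => //; split => //; exists 0%N => //; exists x.
apply: le_trans (future_outer_sigma_subadditive _ _) _.
by rewrite eseries0// => n _ _; exact: U0.
Qed.

(** The limit set is strictly invariant, so it is null or has full measure. Recurrence, applied to
    [rho] itself, puts [D] inside it up to a null set, which excludes the first case. *)
Lemma ergodic_past_limsup (rho : probability (two_sided S) R) D :
  ergodic_measure (S : two_sided S -> two_sided S) rho -> measF D -> 0 < rho D ->
  rho (~` past_limsup D) = 0.
Proof.
move=> [inv erg] mD D0; have mD' := future_two_sided mD.
have mP := measurable_past_limsup mD'.
have [P0|//] := erg _ mP (past_limsup_preimage D).
have := @future_outer_recurrence (restr_future rho) D.
rewrite (@outer_invariantE (restr_future rho) rho)//; last first.
- exact: measurableD.
- by rewrite ltey_eq fin_num_measure.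
move=> /(_ _ mD') DP0; suff : rho D <= 0 by rewrite leNgt D0.
have -> : rho D = rho (D `\` past_limsup D) + rho (D `&` past_limsup D).
  exact: measureDI.
rewrite DP0 ?add0e; last by rewrite ltey_eq fin_num_measure.
by rewrite -P0 le_measure ?inE//; exact: measurableI.
Qed.

(** Points of the limit set are covered by their first visits to [D] along the backward orbit: each
    piece is brought back into [D], where [psi] is below [c rho]; the pieces are disjoint, and
    invariance sums them to at most [c rho]. They are future sets when cut out of a future set [C],
    and a covering of [Q] nearly optimal for [rho] reduces [Q] to this case. *)
Lemma future_outer_past_limsup_le psi rho D (c : R) Q :
  psi setT < +oo -> rho setT < +oo ->
  invariant_measure (S : two_sided S -> two_sided S) rho ->
  measF D -> (0 <= c)%R ->
  (forall F, measF F -> F `<=` D -> psi F <= c%:E * rho F) -> measB Q ->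
  H psi (Q `&` past_limsup D) <= c%:E * rho Q.
Proof.
move=> fin rfin inv mD c0 le_psi mQ.
have step C : measF C -> H psi (C `&` past_limsup D) <= c%:E * rho C.
  move=> mC; pose U n := C `&` iter n S @` D.
  have mU n : measB (U n).
    apply: measurableI; first exact: future_two_sided.
    by apply: two_sided_measurable_image => //; exact: future_two_sided.
  (* First visits, carried back into [D]. For [k <= n] the set [S^-n (S^k D)] is [S^-(n-k) D], so
     earlier visits are removed within the future. *)
  pose F n := iter n S @^-1` (seqDU U n).
  have mFF n : measF (F n).
    have -> : F n = (iter n S @^-1` U n) `\` \bigcup_(k < n) (iter n S @^-1` U k).
      by rewrite /F /seqDU -bigcup_mkord -preimage_bigcup.
    have mnU k : (k <= n)%N -> measF (iter n S @^-1` U k).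
      move=> kn; rewrite /U preimage_setI -(subnKC kn) preimage_image_iter//.
      by apply: measurableI; exact: future_measurable_preimage.
    apply: measurableD; first exact: mnU.
    by apply: bigcup_measurable => k /= kn; apply: mnU; exact: ltnW.
  have FD n : F n `<=` D.
    by rewrite -[X in _ `<=` X](preimage_iter_imageK S_bij n) => x [[]].
  apply: (@le_trans _ _ (\sum_(n <oo) psi (F n))).
    apply: future_outer_le_cover; split=> // x [Cx Dx].
    have [k _ Dkx] := Dx 0%N I.
    have : (\bigcup_n U n) x by exists k.
    rewrite seqDU_bigcup_eq => -[n _ Ux]; exists n => //.
    by rewrite /F image_iter_preimageK.
  apply: (@le_trans _ _ (\sum_(n <oo) c%:E * rho (F n))).
    apply: lee_nneseries => [n _ _|n _]; first exact: measure_ge0.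
    exact: le_psi.
  rewrite nneseriesZl; last by move=> *; exact: measure_ge0.
  apply: lee_wpmul2l; first by rewrite lee_fin.
  have mSU n : measB (seqDU U n).
    by apply: measurableD => //; exact: bigsetU_measurable.
  under eq_eseriesr do rewrite /F invariant_preimage_iter//.
  rewrite -measure_semi_bigcup//.
  - rewrite -seqDU_bigcup_eq; apply: le_measure; rewrite ?inE.
    + exact: bigcupT_measurable.
    + exact: future_two_sided.
    + by move=> x [n _ []].
  - exact: bigcupT_measurable.
have rQfin : rho Q \is a fin_num.
  rewrite ge0_fin_numE//; apply: le_lt_trans rfin.
  by rewrite le_measure ?inE.
apply/lee_addgt0Pr => e e0.
(* Makes [c e' <= e]; the added 1 covers [c = 0]. *)
pose e' := (e / (c + 1))%R.
have e'0 : (0 < e')%R by rewrite divr_gt0// ltr_wpDl.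
have [|B [mB QB] sumB] := @future_outer_lt _ _ _ S (restr_future rho) Q (rho Q + e'%:E).
  rewrite (@outer_invariantE (restr_future rho) rho)//.
  by rewrite lteDl// lte_fin.
apply: (@le_trans _ _ (\sum_(n <oo) H psi (iter n S @` (B n `&` past_limsup D)))).
  apply: (le_trans _ (future_outer_sigma_subadditive _ _)).
  apply: le_future_outer => x [Qx Dx]; have [n _ [y By yx]] := QB x Qx.
  (* The limit set is invariant: with [x] it contains the [n]-th predecessor [y] of [x]. *)
  exists n => //; exists y => //; split => //.
  by rewrite -(past_limsup_preimage_iter D n) /preimage /= yx.
apply: (@le_trans _ _ (\sum_(n <oo) c%:E * rho (B n))).
  apply: lee_nneseries => [n _ _|n _]; first exact: future_outer_ge0.
  apply: le_trans (step _ (mB n)).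
  exact: le_future_outer_image.
rewrite nneseriesZl; last by move=> *; exact: measure_ge0.
apply: (@le_trans _ _ (c%:E * (rho Q + e'%:E))).
  by apply: lee_wpmul2l; [rewrite lee_fin|exact: ltW].
rewrite ge0_muleDr ?measure_ge0 ?lee_fin ?(ltW e'0)//.
rewrite leeD2l// -EFinM lee_fin /e' mulrA ler_pdivrMr ?ltr_wpDl// mulrC.
by rewrite ler_pM2l// lerDl.
Qed.

End invariant.

(** * Sums over a countable index set *)

Lemma nneseries_pickle_inv (R : realType) (I : countType) (g : I -> \bar R) :
  (forall i, 0 <= g i) ->
  \sum_(n <oo) oapp g 0 (pickle_inv n) = \esum_(i in [set: I]) g i.
Proof.
move=> g0; pose a n := oapp g 0 (pickle_inv n : option I).
have a0 n : 0 <= a n by rewrite /a; case: (pickle_inv n) => /=.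
rewrite nneseries_esumT//.
rewrite -(eq_esum (fun i _ => congr1 (oapp g 0) (pickleK_inv i))).
have <- := @esum_image R I nat setT pickle a (in2W (pcan_inj pickleK_inv)).
rewrite [RHS]esum_mkcond; apply: eq_esum => n _; case: ifPn => // nr.
case E : (pickle_inv n) => [i|//]; exfalso; move/negP: nr; apply.
by rewrite inE; exists i => //; have := @pickle_invK I n; rewrite E.
Qed.

Lemma esum_unique (R : realType) (I : choiceType) (g : I -> \bar R) i :
  (forall j, 0 <= g j) -> (forall j, j <> i -> g j = 0) ->
  \esum_(j in [set: I]) g j = g i.
Proof.
move=> g0 gi; rewrite (esumID [set i])//.
rewrite setTI esum_set1// esum1 ?adde0// => j [_ ji]; exact: gi.
Qed.

Lemma lee_mulr_gt (R : realType) (x y : \bar R) (r : R) : (0 <= r)%R ->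
  0 <= y -> y \is a fin_num ->
  (forall c, (r < c)%R -> x <= c%:E * y) -> x <= r%:E * y.
Proof.
case: y => [s| |] // r0; rewrite lee_fin => s0 _ xy.
apply/lee_addgt0Pr => e e0.
have e' : (0 < e / (s + 1))%R by rewrite divr_gt0// ltr_wpDl.
apply: (le_trans (xy (r + e / (s + 1))%R _)); first by rewrite ltrDl.
rewrite -!EFinM -EFinD lee_fin mulrDl lerD2l mulrAC ler_pdivrMr ?ltr_wpDl//.
by rewrite ler_pM2l// lerDl.
Qed.

(** * Separating distinct ergodic measures by future sets *)

Section separation.
Context d (X : measurableType d) (R : realType) (S : X -> X).
Context (S_bij : bijective S).

Local Notation measF := (@measurable _ (future S)).
Local Notation measB := (@measurable _ (two_sided S)).
Local Notation ergodic := (@ergodic_measure _ (two_sided S) R S).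

(** If an invariant Hahn set [W] had the same mass for both measures, its maximality would put one
    below the other on the future; complements would make them equal there, and invariance on all
    two-sided sets. So the masses differ, and by ergodicity they are 0 and 1. The Hahn set is taken
    on the future because the densities live there. *)
Lemma ergodic_separation (r1 r2 : probability (two_sided S) R) :
  ergodic r1 -> ergodic r2 -> (exists2 A, measB A & r1 A <> r2 A) ->
  exists P, [/\ measF P, r1 (~` P) = 0 & r2 P = 0].
Proof.
move=> [inv1 erg1] [inv2 erg2] [A mA r12].
pose m1 : {finite_measure set (future S) -> \bar R} := restr_future r1.
pose m2 : {finite_measure set (future S) -> \bar R} := restr_future r2.
have mS B : measF B -> measF (S @^-1` B) by exact: (future_measurable_preimage 1).
have restr_inv (r : probability (two_sided S) R) :
    invariant_measure (S : two_sided S -> two_sided S) r ->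
    @invariant_measure _ (future S) R S (restr_future r).
  by move=> inv B mB; apply: inv; exact: future_two_sided.
have [W mW [SW W1 W2]] :=
  @exists_hahn_invariant _ (future S) R S m1 m2 mS (restr_inv r1 inv1) (restr_inv r2 inv2).
have mWB := future_two_sided mW.
have fin (r : probability (two_sided S) R) B : measB B -> r B = (fine (r B))%:E.
  by move=> mB; rewrite fineK// fin_num_measure.
have W12 : r1 W <> r2 W.
  move=> r12W; apply: r12.
  have le12 B : measF B -> r1 B <= r2 B.
    move=> mB; have mB' := future_two_sided mB.
    have : r1 B + r2 W <= r1 W + r2 B by exact: (measure_le_on_max mW mB W1 W2).
    by rewrite r12W addeC leeD2lE// fin_num_measure.
  have eq12 B : measF B -> r1 B = r2 B.
    move=> mB; have mB' := future_two_sided mB.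
    apply/eqP; rewrite eq_le le12//=.
    have := le12 _ (measurableC mB); rewrite !probability_setC//.
    by rewrite (fin r1)// (fin r2)// -!EFinB !lee_fin lerD2l lerN2.
  have finT : m1 setT < +oo by rewrite ltey_eq fin_num_measure.
  rewrite -(@outer_invariantE _ X R S S_bij m1 r1 A inv1)//.
  by rewrite -(@outer_invariantE _ X R S S_bij m1 r2 A inv2)// => B /eq12.
have C0 (r : probability (two_sided S) R) : r (~` W) = 0 -> r W = 1.
  move=> rW; have := probability_setT r; rewrite -(setUv W) measureU ?setICr//.
    by rewrite [X in _ + X]rW adde0.
  exact: measurableC.
have [w1|w1] := erg1 _ mWB SW; have [w2|w2] := erg2 _ mWB SW.
- by case: W12; rewrite w1 w2.
- by exists (~` W); split; rewrite ?setCK//; exact: measurableC.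
- by exists W.
- by case: W12; rewrite !C0.
Qed.

Lemma ergodic_family_separation (I : countType)
    (L : I -> probability (two_sided S) R) : (forall i, ergodic (L i)) ->
  (forall i j, i <> j -> exists2 A, measB A & L i A <> L j A) ->
  exists Xs : I -> set X, [/\ forall i, measF (Xs i),
    forall i, L i (~` Xs i) = 0, forall i j, i <> j -> L j (Xs i) = 0 &
    forall i j, i <> j -> Xs i `&` Xs j = set0].
Proof.
move=> erg dist.
have /choice[P PP] (p : I * I) : exists P, measF P /\
    (p.1 <> p.2 -> L p.1 (~` P) = 0 /\ L p.2 P = 0).
  have [e|e] := pselect (p.1 = p.2); first by exists set0; split=> // /(_ e).
  by have [Q [mQ Q1 Q2]] := ergodic_separation (erg p.1) (erg p.2) (dist _ _ e); exists Q.
have mP p : measF (P p) by have [] := PP p.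
(* Removing [P (j, i)] costs [L i] nothing and makes the sets disjoint everywhere, not merely up to
   null sets. *)
pose G i (n : nat) := if pickle_inv n is Some j then
  if j == i then setT else P (i, j) `\` P (j, i) else setT.
have mG i n : measF (G i n).
  by rewrite /G; case: (pickle_inv n) => [j|//]; case: ifP => // _; exact: measurableD.
pose Xs i := \bigcap_n G i n.
have mXs i : measF (Xs i) by exact: bigcapT_measurable.
have XsP i j x : i <> j -> Xs i x -> P (i, j) x /\ ~ P (j, i) x.
  move=> ij /(_ (pickle j) Logic.I); rewrite /G pickleK_inv.
  by case: eqP => [/esym//|_ []].
exists Xs; split=> // [i|i j ij|i j ij].
- apply/eqP; rewrite -measure_le0 /Xs setC_bigcap.
  have mGC n : measB (~` G i n) by apply: future_two_sided; exact: measurableC.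
  apply: (@le_trans _ _ (\sum_(n <oo) L i (~` G i n))).
    apply: measure_sigma_subadditive => //; exact: bigcupT_measurable.
  rewrite eseries0// => n _ _; rewrite /G.
  case: (pickle_inv n) => [j|]; last by rewrite setCT measure0.
  case: eqP => [_|ji]; first by rewrite setCT measure0.
  have [_ /(_ (fun e => ji (esym e))) [/= Pij _]] := PP (i, j).
  have [_ /(_ ji) [/= _ Pji]] := PP (j, i).
  rewrite setDE setCI setCK; apply: null_set_setU => //.
    by apply: measurableC; exact: future_two_sided.
  exact: future_two_sided.
- have [_ /(_ ij) [/= _ Pij]] := PP (i, j).
  apply: subset_measure0 Pij; try exact: future_two_sided.
  by move=> x /(XsP _ _ _ ij) [].
- apply/seteqP; split=> // x [Xi Xj].
  by have [_] := XsP _ _ _ ij Xi; have [] := XsP _ _ _ (fun e => ij (esym e)) Xj.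
Qed.

End separation.

(** * Powers near an essential bound *)

Section epow.
Context (R : realType).
Implicit Types (x y E : \bar R) (z r v w a b c t : R).

Lemma lte_inve x y : 0 <= x -> x < y -> y^-1 < x^-1.
Proof.
case: x => [x| |]//; case: y => [y| |]//; rewrite ?lee_fin ?lte_fin.
- move=> x0 xy; have y0 : (0 < y)%R := le_lt_trans x0 xy.
  rewrite !inver gt_eqF//; case: eqP => [_|/eqP xn0]; first by rewrite ltry.
  by rewrite lte_fin ltf_pV2// posrE lt_neqAle eq_sym xn0.
- move=> x0 _; rewrite invey inver; case: eqP => [_|/eqP xn0]; first by rewrite ltry.
  by rewrite lte_fin invr_gt0 lt_neqAle eq_sym xn0.
Qed.

Lemma lee_inve x y : 0 <= x -> x <= y -> y^-1 <= x^-1.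
Proof.
by move=> x0; rewrite le_eqVlt => /predU1P[->//|xy]; exact/ltW/lte_inve.
Qed.

Lemma epow_ge0 x r : 0 <= epow x r.
Proof. by rewrite /epow; case: ifP => _; exact: poweR_ge0. Qed.

Lemma epowE x r : (0 <= r)%R -> epow x r = x `^ r.
Proof. by rewrite /epow ltNge => ->. Qed.

Lemma epow0 x : epow x 0 = 1.
Proof. by rewrite /epow ltxx poweRe0. Qed.

(** Inversion exchanges suprema and infima, so that the approximations near an essential infimum are
    read off from those near a supremum. *)
Lemma epow_inve x r : epow x^-1 (- r) = epow x r.
Proof.
rewrite /epow oppr_lt0 inveK opprK.
by have [r0|r0|->] := ltgtP r 0%R; rewrite ?oppr0 ?poweRe0.
Qed.

Lemma epow_fin z r : (0 < z)%R -> epow z%:E r = (z `^ r)%:E.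
Proof.
move=> z0; rewrite /epow inver gt_eqF// !poweR_EFin; case: ifP => // _.
by rewrite -powR_inv1 ?ltW// -powRrM mulN1r opprK.
Qed.

Lemma epow_lt x y r : 0 <= x -> (0 < r)%R -> x < y -> epow x r < epow y r.
Proof.
move=> x0 r0 xy; rewrite !epowE ?ltW//.
case: x y x0 xy => [x| |] [y| |]//; rewrite ?lee_fin ?lte_fin => x0 xy.
  by rewrite gt0_ltr_powR// nnegrE ltW// (le_lt_trans x0).
by rewrite poweRyr ?gt_eqF// ltry.
Qed.

Lemma epow_le x y r : 0 <= x -> (0 <= r)%R -> x <= y -> epow x r <= epow y r.
Proof.
rewrite (le_eqVlt 0%R) (le_eqVlt x) => x0 /predU1P[<-|r0]; first by rewrite !epow0.
by move=> /predU1P[->//|xy]; exact/ltW/epow_lt.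
Qed.

Lemma epow_gt x y r : 0 <= x -> (r < 0)%R -> x < y -> epow y r < epow x r.
Proof.
move=> x0 r0 xy; rewrite -(epow_inve x) -(epow_inve y).
apply: epow_lt; [|by rewrite oppr_gt0|exact: lte_inve].
by rewrite inve_ge0 (le_trans x0)// ltW.
Qed.

Lemma epow_ge x y r : 0 <= x -> (r <= 0)%R -> x <= y -> epow y r <= epow x r.
Proof.
rewrite (le_eqVlt r) (le_eqVlt x) => x0 /predU1P[->|r0]; first by rewrite !epow0.
by move=> /predU1P[->//|xy]; exact/ltW/epow_gt.
Qed.

Lemma epowM_gt0 z x r : (0 < z)%R -> 0 <= x ->
  epow (z%:E * x) r = (z `^ r)%:E * epow x r.
Proof.
move=> z0 x0; rewrite -(epow_fin r z0) /epow; case: ifP => r0; last first.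
  by rewrite poweRM// lee_fin ltW.
rewrite -poweRM ?inve_ge0//; last by rewrite lee_fin ltW.
congr (_ `^ _); case: x x0 => [x| |]//.
  rewrite lee_fin -EFinM !inver mulf_eq0 (gt_eqF z0)/= => x0.
  case: eqP => _; last by rewrite invfM.
  by rewrite gt0_muley// lte_fin invr_gt0.
by move=> _; rewrite gt0_muley ?lte_fin// invey mule0.
Qed.

(* The two regimes: [z] ranges below its essential supremum [E] when
   [dir = true], above its essential infimum [E] otherwise. *)
Definition range_side (dir : bool) E x := if dir then x <= E else E <= x.
(** The threshold comes first: [near_side dir z0 y] says that [y] lies beyond [z0] in the direction
    of the extremum. *)
Definition near_side (dir : bool) x y := if dir then x < y else y < x.
(** What remains true of an essential bound when the function is almost everywhere positive and
    finite: a supremum may still be infinite and an infimum may still be 0. *)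
Definition range_bound (dir : bool) E := if dir then 0 < E else 0 <= E < +oo.

Lemma range_bound_inve dir E : range_bound dir E -> range_bound (~~ dir) E^-1.
Proof.
case: dir => /= [E0|/andP[E0 Ey]].
  by rewrite inve_ge0 ltW//= ltey inve_eqy gt_eqF.
by rewrite -invey; exact: lte_inve.
Qed.

Let inve_fin z : (0 < z)%R -> z%:E^-1 = (z^-1)%:E.
Proof. by move=> z0; rewrite inver gt_eqF. Qed.

Let powRV z r : (0 < z)%R -> (z^-1 `^ (- r) = z `^ r)%R.
Proof.
move=> z0; apply: EFin_inj; rewrite -!epow_fin ?invr_gt0//.
by rewrite -inve_fin// epow_inve.
Qed.

(** For [r < 0] the threshold solves [z0 ^ r = v]. For [r >= 0] the power is at most its value at
    [E], and any positive threshold below [E] serves. *)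
Lemma epow_upper_sup E r v : 0 < E -> epow E r < v%:E ->
  exists z0, [/\ (0 < z0)%R, z0%:E < E &
    forall z, (z0 < z)%R -> z%:E <= E -> (z `^ r <= v)%R].
Proof.
move=> E0 Ev; have [r0|r0] := ltP r 0%R.
  have v0 : (0 < v)%R by rewrite -lte_fin (le_lt_trans (epow_ge0 E r)).
  have [z0 z00 z0E] : exists2 z0, (0 < z0)%R & (z0 `^ r = v)%R.
    exists (v `^ r^-1)%R; first exact: powR_gt0.
    by rewrite -powRrM mulVf ?lt_eqF// powRr1// ltW.
  exists z0; split => // [|z z0z zE].
    rewrite ltNge; apply/negP => Ez0; have := epow_ge (ltW E0) (ltW r0) Ez0.
    by rewrite epow_fin// z0E leNgt Ev.
  rewrite -lee_fin -z0E -!epow_fin//; last exact: lt_trans z0z.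
  by apply: epow_ge; rewrite ?lee_fin ltW.
have [z0 z00 z0E] : exists2 z0, (0 < z0)%R & z0%:E < E.
  case: E E0 {Ev} => [E| |]//; last by exists 1%R; rewrite ?ltry.
  by rewrite lte_fin => E0; exists (E / 2)%R; rewrite ?lte_fin; lra.
exists z0; split => // z z0z zE; rewrite -lee_fin; apply: le_trans (ltW Ev).
have zpos := lt_trans z00 z0z.
by rewrite -epow_fin//; apply: epow_le; rewrite ?lee_fin ?(ltW zpos).
Qed.

Lemma epow_lower_sup E r w : 0 < E -> w%:E < epow E r ->
  exists z0, [/\ (0 < z0)%R, z0%:E < E &
    forall z, (z0 < z)%R -> z%:E <= E -> (w <= z `^ r)%R].
Proof.
move=> E0 wE; have [z1 z10 z1E] : exists2 z0, (0 < z0)%R & z0%:E < E.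
  case: E E0 {wE} => [E| |]//; last by exists 1%R; rewrite ?ltry.
  by rewrite lte_fin => E0; exists (E / 2)%R; rewrite ?lte_fin; lra.
have [r0|r0] := leP r 0%R.
  exists z1; split => // z z1z zE; rewrite -lee_fin; apply: (le_trans (ltW wE)).
  have zpos := lt_trans z10 z1z.
  by rewrite -epow_fin//; apply: epow_ge; rewrite ?lee_fin ?(ltW zpos).
have [w0|w0] := leP w 0%R.
  by exists z1; split => // z _ _; exact: le_trans w0 (powR_ge0 _ _).
have [z0 z00 z0E] : exists2 z0, (0 < z0)%R & (z0 `^ r = w)%R.
  exists (w `^ r^-1)%R; first exact: powR_gt0.
  by rewrite -powRrM mulVf ?gt_eqF// powRr1// ltW.
exists z0; split => // [|z z0z zE].
  rewrite ltNge; apply/negP => Ez0; have := epow_le (ltW E0) (ltW r0) Ez0.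
  by rewrite epow_fin// z0E leNgt wE.
rewrite -lee_fin -z0E -!epow_fin//; last exact: lt_trans z0z.
by apply: epow_le; rewrite ?lee_fin ltW.
Qed.

Let flip_near z0 z : (0 < z0)%R -> (0 < z)%R -> (z < z0^-1)%R -> (z0 < z^-1)%R.
Proof. by move=> z00 z1; rewrite -{2}(invrK z0) ltf_pV2// posrE invr_gt0. Qed.

Let flip_bound z0 E : (0 < z0)%R -> 0 <= E -> z0%:E < E^-1 -> E < (z0^-1)%:E.
Proof.
move=> z00 E0 z0E; rewrite -inve_fin// -(inveK E).
by apply: lte_inve => //; rewrite lee_fin ltW.
Qed.

Lemma epow_upper dir E r v : range_bound dir E -> epow E r < v%:E ->
  exists z0, [/\ (0 < z0)%R, near_side dir z0%:E E &
    forall z, (0 < z)%R -> near_side dir z0%:E z%:E -> range_side dir E z%:E ->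
    (z `^ r <= v)%R].
Proof.
case: dir => /= [E0 Ev|/[dup] bE /andP[E0 Ey]].
  have [z0 [z00 z0E z0P]] := epow_upper_sup E0 Ev.
  by exists z0; split => // z _; rewrite lte_fin; exact: z0P.
rewrite -epow_inve => Ev.
have [z0 [z00 z0E z0P]] := epow_upper_sup (range_bound_inve (dir := false) bE) Ev.
exists z0^-1%R; split; [by rewrite invr_gt0|exact: flip_bound|move=> z zpos].
rewrite lte_fin => zz0 Ez; rewrite -powRV//; apply: z0P; first exact: flip_near.
by rewrite -inve_fin//; exact: lee_inve.
Qed.

Lemma epow_lower dir E r w : range_bound dir E -> w%:E < epow E r ->
  exists z0, [/\ (0 < z0)%R, near_side dir z0%:E E &
    forall z, (0 < z)%R -> near_side dir z0%:E z%:E -> range_side dir E z%:E ->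
    (w <= z `^ r)%R].
Proof.
case: dir => /= [E0 Ev|/[dup] bE /andP[E0 Ey]].
  have [z0 [z00 z0E z0P]] := epow_lower_sup E0 Ev.
  by exists z0; split => // z _; rewrite lte_fin; exact: z0P.
rewrite -epow_inve => Ev.
have [z0 [z00 z0E z0P]] := epow_lower_sup (range_bound_inve (dir := false) bE) Ev.
exists z0^-1%R; split; [by rewrite invr_gt0|exact: flip_bound|move=> z zpos].
rewrite lte_fin => zz0 Ez; rewrite -powRV//; apply: z0P; first exact: flip_near.
by rewrite -inve_fin//; exact: lee_inve.
Qed.

(** The sign of [r] for which [z ^ r] is smallest at the extremum; [r] will be [a - 1], negative for
    [a < 1] and positive for [a > 1]. *)
Definition exponent_side (dir : bool) r := if dir then (r < 0)%R else (0 < r)%R.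

Lemma epow_extremum dir E r : range_bound dir E -> exponent_side dir r ->
  epow E r \is a fin_num.
Proof.
rewrite ge0_fin_numE ?epow_ge0//; case: dir => /= [E0|/andP[E0 Ey]] r0.
  rewrite /epow r0; apply: poweR_lty; by rewrite ltey inve_eqy gt_eqF.
by rewrite epowE ?ltW//; exact: poweR_lty.
Qed.

Lemma epow_extremum_le dir E r z : range_bound dir E -> exponent_side dir r ->
  (0 < z)%R -> range_side dir E z%:E -> epow E r <= (z `^ r)%:E.
Proof.
case: dir => /= [E0|/andP[E0 Ey]] r0 z0 zE; rewrite -epow_fin//.
  by apply: epow_ge => //; [rewrite lee_fin ltW|exact: ltW].
by apply: epow_le => //; exact: ltW.
Qed.

(** Away from the extremum the power exceeds its minimum by a fixed amount, which a large multiplier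
    turns into an arbitrarily large cost. *)
Lemma epow_extremum_gap dir E r z0 : range_bound dir E -> exponent_side dir r ->
  (0 < z0)%R -> near_side dir z0%:E E ->
  exists2 h, (0 < h)%R & forall z, (0 < z)%R -> ~ near_side dir z0%:E z%:E ->
    (fine (epow E r) + h <= z `^ r)%R.
Proof.
move=> bE r0 z00 z0E; have fE := epow_extremum bE r0.
have lt : (fine (epow E r) < z0 `^ r)%R.
  rewrite -lte_fin fineK// -epow_fin//.
  case: dir bE r0 z0E {fE} => /= [E0|/andP[E0 Ey]] r0 z0E.
    by apply: epow_gt => //; rewrite lee_fin ltW.
  exact: epow_lt.
exists (z0 `^ r - fine (epow E r))%R; first by rewrite subr_gt0.
move=> z zpos nz; rewrite addrC subrK -lee_fin -!epow_fin//.
case: dir r0 nz {bE z0E lt fE} => /= r0 /negP; rewrite -leNgt => zz0.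
  by apply: epow_ge; rewrite ?lee_fin ?(ltW zpos) ?(ltW r0).
by apply: epow_le; rewrite ?lee_fin ?(ltW z00) ?(ltW r0).
Qed.

(** The margin [h] between [c] and the value at [E] is shared equally by the two summands. The
    weight [t = 0] is separate since the second power may then be infinite at [E]; for [t > 0] the
    strict inequality forces it to be finite. *)
Lemma two_powers_upper dir E r1 r2 t c : range_bound dir E ->
  exponent_side dir r1 -> (0 <= t)%R -> epow E r1 + t%:E * epow E r2 < c%:E ->
  exists z0, [/\ (0 < z0)%R, near_side dir z0%:E E &
    forall z, (0 < z)%R -> near_side dir z0%:E z%:E -> range_side dir E z%:E ->
    (z `^ r1 + t * z `^ r2 <= c)%R].
Proof.
move=> bE side t0 cE; have f1 := epow_extremum bE side.
have [t00|tn0] := eqVneq t 0%R.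
  have [|z0 [z00 z0E z0P]] := @epow_upper dir E r1 c bE.
    by move: cE; rewrite t00 mul0e adde0.
  by exists z0; split => // z *; rewrite t00 mul0r addr0; exact: z0P.
have tpos : (0 < t)%R by rewrite lt_neqAle eq_sym tn0.
have f2 : epow E r2 \is a fin_num.
  rewrite ge0_fin_numE ?epow_ge0// ltey; apply/eqP => E2.
  by move: cE; rewrite E2 gt0_muley ?lte_fin// -(fineK f1) ltNge leey.
move: cE; rewrite -(fineK f1) -(fineK f2) -EFinM -EFinD lte_fin.
set k1 := fine _; set k2 := fine _ => cE.
pose h := (c - (k1 + t * k2))%R; have h0 : (0 < h)%R by rewrite subr_gt0.
have [|z1 [z10 z1E z1P]] := @epow_upper dir E r1 (k1 + h / 2)%R bE.
  by rewrite -(fineK f1) lte_fin ltrDl divr_gt0.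
have [|z2 [z20 z2E z2P]] := @epow_upper dir E r2 (k2 + h / 2 / t)%R bE.
  by rewrite -(fineK f2) lte_fin ltrDl !divr_gt0.
have fin : forall z, (z `^ r1 <= k1 + h / 2 -> z `^ r2 <= k2 + h / 2 / t ->
   z `^ r1 + t * z `^ r2 <= c)%R.
  move=> z le1 le2; have -> : c = (k1 + h / 2 + t * (k2 + h / 2 / t))%R.
    by rewrite mulrDr mulrCA mulfV// mulr1 /h; lra.
  by apply: lerD => //; rewrite ler_pM2l.
exists (if dir then Num.max z1 z2 else Num.min z1 z2).
case: dir bE side z1E z1P z2E z2P => /= bE side z1E z1P z2E z2P.
  split; first by rewrite lt_max z10.
    by rewrite EFin_max gt_max z1E.
  move=> z zpos; rewrite lte_fin gt_max => /andP[zz1 zz2] zE.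
  by apply: fin; [exact: z1P|exact: z2P].
split; first by rewrite lt_min z10.
  by rewrite EFin_min lt_min z1E.
move=> z zpos; rewrite lte_fin lt_min => /andP[zz1 zz2] zE.
by apply: fin; [exact: z1P|exact: z2P].
Qed.

(** [K = w / h]: beyond the threshold the second power alone reaches [w], and elsewhere the gap [h]
    of the first power, multiplied by [K], pays for [w]. *)
Lemma two_powers_lower dir E r1 r2 w : range_bound dir E ->
  exponent_side dir r1 -> (0 <= w)%R -> w%:E < epow E r2 ->
  exists2 K, (0 <= K)%R & forall z, (0 < z)%R -> range_side dir E z%:E ->
    (K * fine (epow E r1) + w <= K * z `^ r1 + z `^ r2)%R.
Proof.
move=> bE side w0 wE; have f1 := epow_extremum bE side.
have [z0 [z00 z0E z0P]] := epow_lower bE wE.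
have [h h0 hP] := epow_extremum_gap bE side z00 z0E.
have wh0 : (0 <= w / h)%R by rewrite divr_ge0// ltW.
exists (w / h)%R => // z zpos zE.
have [near|nnear] := pselect (near_side dir z0%:E z%:E).
  apply: lerD; last exact: z0P.
  by rewrite ler_wpM2l// -lee_fin fineK// (epow_extremum_le bE).
apply: (@le_trans _ _ (w / h * (fine (epow E r1) + h)))%R.
  by rewrite mulrDr divfK// gt_eqF.
rewrite -[leLHS]addr0; apply: lerD; last exact: powR_ge0.
by rewrite ler_wpM2l// hP.
Qed.

(* Multiply the weighted AM-GM inequality e^s <= s e + (1 - s) by e^-1. *)
Lemma epow_pred_le E s : 0 < E -> (0 < s < 1)%R ->
  epow E (s - 1) <= epow E (0 - 1) + s%:E.
Proof.
move=> E0 /andP[s0 s1]; case: E E0 => [e| |]// e0; last first.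
  have -> : epow +oo (s - 1) = 0 :> \bar R.
    by rewrite /epow subr_lt0 s1 invey poweR0r// oppr_eq0 subr_eq0 lt_eqF.
  by rewrite adde_ge0 ?epow_ge0// lee_fin ltW.
rewrite lte_fin in e0; rewrite !epow_fin// -EFinD lee_fin /powR gt_eqF//.
set u := ln e; set c := expR ((s - 1) * u).
have c0 : (0 < c)%R by exact: expR_gt0.
have h1 : (c * (1 + (1 - s) * u) <= 1)%R.
  apply: (@le_trans _ _ (c * expR ((1 - s) * u))%R).
    by rewrite ler_pM2l// expR_ge1Dx.
  by rewrite /c -expRD -mulrDl (_ : s - 1 + (1 - s) = 0)%R ?mul0r ?expR0//; ring.
have h2 : (c * (1 - s * u) <= expR ((0 - 1) * u))%R.
  apply: (@le_trans _ _ (c * expR (- (s * u)))%R).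
    by rewrite ler_pM2l// expR_ge1Dx.
  by rewrite /c -expRD le_eqVlt; apply/orP; left; apply/eqP; congr expR; ring.
have h3 := expR_ge0 ((0 - 1) * u); nra.
Qed.

End epow.

(** * Finite families, infinite coefficients and splitting of costs *)

Lemma esumZl (R : realType) (I : countType) (g : I -> \bar R) (c : R) :
  (0 <= c)%R -> (forall i, 0 <= g i) ->
  \esum_(i in [set: I]) (c%:E * g i) = c%:E * \esum_(i in [set: I]) g i.
Proof.
move=> c0 g0; rewrite -!nneseries_pickle_inv//; last first.
  by move=> i; rewrite mule_ge0// lee_fin.
rewrite -nneseriesZl; last by move=> n _; case: pickle_inv => /=.
by apply: eq_eseriesr => n _; case: pickle_inv => //=; rewrite mule0.
Qed.

Lemma esum_le_seq (R : realType) (I : choiceType) (a : I -> \bar R) x :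
  (forall s : seq I, uniq s -> \sum_(i <- s) a i <= x) ->
  \esum_(i in [set: I]) a i <= x.
Proof.
move=> ax; apply: ge_ereal_sup => _ [F [finF _] <-].
by rewrite fsbig_finite//; apply: ax; exact: finmap.fset_uniq.
Qed.

Lemma seq_le_esum (R : realType) (I : choiceType) (a : I -> \bar R) s :
  uniq s -> \sum_(i <- s) a i <= \esum_(i in [set: I]) a i.
Proof.
move=> us; apply: esum_ge; exists [set` s]; first by split.
by rewrite -fsbig_seq.
Qed.

Lemma mule_nneseries_le (R : realType) (c : \bar R) (u : nat -> \bar R) :
  0 <= c -> (forall n, 0 <= u n) ->
  c * \sum_(n <oo) u n <= \sum_(n <oo) c * u n.
Proof.
case: c => [c| |]// c0 u0; first by rewrite nneseriesZl.
have [[n un]|/forallNP u_eq0] := pselect (exists n, 0 < u n).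
  by rewrite [leRHS](@eseries_pinfty _ _ _ n) ?leey// ?gt0_mulye// => k _;
    rewrite -ltNye (lt_le_trans _ (mule_ge0 c0 (u0 k))).
have {}u_eq0 n : u n = 0.
  by apply/eqP; rewrite eq_le u0 andbT leNgt; apply/negP/u_eq0.
by rewrite !eseries0 ?mule0// => n _ _; rewrite u_eq0 mule0.
Qed.

Lemma lee_cancel_excess (R : realType) (W h y : \bar R) (K e : R) :
  W \is a fin_num -> h \is a fin_num ->
  K%:E * h + W <= K%:E * (h + e%:E) + y -> W - (K * e)%:E <= y.
Proof.
case: W => [W| |]// _; case: h => [h| |]// _; case: y => [y| |]; rewrite ?leey//=.
by rewrite -!EFinM -!EFinD !lee_fin; lra.
Qed.

(** [h] stands for the least possible value of [A]: a bound on the combined cost leaves an excess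
    below [t c] to [A] and at most [c] to [B]. *)
Lemma split_excess (R : realType) (A B : \bar R) (h t c : R) :
  0 <= A -> 0 <= B -> (0 < t)%R -> h%:E <= A ->
  A + t%:E * B < (h + t * c)%:E -> A < (h + t * c)%:E /\ B <= c%:E.
Proof.
move=> + + t0; case: A => [A| |]//; case: B => [B| |]//.
- rewrite -EFinM -EFinD !lee_fin !lte_fin => A0 B0 hA AB; split.
    by apply: le_lt_trans AB; rewrite lerDl mulr_ge0// ltW.
  by rewrite -(ler_pM2l t0) ltW//; lra.
- by move=> _ _ _; rewrite gt0_muley ?lte_fin.
- move=> _ B0 _; rewrite addye ?ltNge ?leey//.
  by rewrite -ltNye (lt_le_trans (ltNyr 0%R))// mule_ge0// lee_fin ltW.
Qed.

Lemma lee_mul_approx (R : realType) (c k y l : \bar R) :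
  c \is a fin_num -> 0 <= c -> 0 <= k -> 0 <= y ->
  (forall v : R, (0 <= v)%R -> v%:E < k \/ v = 0%R -> c * v%:E + y <= l) ->
  c * k + y <= l.
Proof.
case: c => [c| |]// _; rewrite lee_fin => c0 k0 y0 vP.
have yl : y <= l by have := vP 0%R (lexx _) (or_intror erefl); rewrite mule0 add0e.
have [c_eq0|c_neq0] := eqVneq c 0%R; first by rewrite c_eq0 mul0e add0e.
have {c_neq0}c0 : (0 < c)%R by rewrite lt_neqAle eq_sym c_neq0.
case: l yl vP => [l| |] yl vP; rewrite ?leey//; last first.
  by have := le_trans y0 yl.
case: y y0 yl vP => [y| |]//; rewrite !lee_fin => y0 yl vP.
have v0 : (0 <= (l - y) / c)%R by rewrite divr_ge0 ?subr_ge0// ltW.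
case: k k0 vP => [k| |]// k0 vP; last first.
  (* At this value the left side is [l + c], beyond [l]. *)
  have := vP ((l - y) / c + 1)%R; rewrite -EFinM -EFinD lee_fin.
  rewrite mulrDr mulrCA mulfV ?gt_eqF// mulr1 => H.
  have := H (addr_ge0 v0 ler01) (or_introl (ltry _)).
  by rewrite mulr1 => le_l; exfalso; clear -c0 le_l; lra.
rewrite -EFinM -EFinD lee_fin leNgt; apply/negP => lk.
have vk : ((l - y) / c < k)%R by rewrite ltr_pdivrMr// mulrC; clear -lk; lra.
(* The midpoint of [k] and the value at which the left side equals [l]. *)
have := vP (((l - y) / c + k) / 2)%R; rewrite -EFinM -EFinD lee_fin lte_fin => H.
have := H _ (or_introl _).
have -> : (c * (((l - y) / c + k) / 2) = (l - y + c * k) / 2)%R.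
  by rewrite mulrA mulrDr mulrCA mulfV ?gt_eqF// mulr1.
have h1 : (0 <= ((l - y) / c + k) / 2)%R by move: v0 vk; set q := (_ / c)%R; clear; lra.
have h2 : (((l - y) / c + k) / 2 < k)%R by move: v0 vk; set q := (_ / c)%R; clear; lra.
by move=> /(_ h1 h2); clear -lk; lra.
Qed.

(** One coefficient is raised at a time; [y] is general because it collects the terms already
    treated. *)
Lemma lee_sum_approx (R : realType) (I : eqType) (s : seq I) (c k : I -> \bar R) y l :
  uniq s -> (forall i, c i \is a fin_num) -> (forall i, 0 <= c i) ->
  (forall i, 0 <= k i) -> 0 <= y ->
  (forall w : I -> R, (forall i, 0 <= w i)%R ->
    (forall i, (w i)%:E < k i \/ w i = 0%R) ->
    \sum_(i <- s) c i * (w i)%:E + y <= l) ->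
  \sum_(i <- s) c i * k i + y <= l.
Proof.
move=> us cfin c0 k0; elim: s us y => [_ y y0 wP|j s IH /= /andP[js us] y y0 wP].
  by have := wP (fun=> 0%R) (fun=> lexx _) (fun=> or_intror erefl); rewrite !big_nil.
rewrite big_cons -addeA; apply: lee_mul_approx => //.
  by apply: adde_ge0 => //; apply: sume_ge0 => i _; exact: mule_ge0.
move=> v v0 vk; rewrite addeCA; apply: IH => //.
  by rewrite adde_ge0// mule_ge0// lee_fin.
move=> w w0 wk; pose w' i := if i == j then v else w i.
have := wP w'; rewrite big_cons /w' eqxx addeCA -addeA; rewrite [in X in _ -> X]addeCA.
move=> H; rewrite addeCA addeA.
have := H _ _; rewrite (eq_big_seq (fun i => c i * (w i)%:E)); last first.
  by move=> i si; case: eqP => // ij; rewrite -ij si in js.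
by rewrite addeA; apply => i; case: eqP => // ->.
Qed.

(** * Measures given by a density *)

Section integral_measure.
Context d (T : measurableType d) (R : realType) (mu : {measure set T -> \bar R}).
Context (f : T -> \bar R) (mf : measurable_fun setT f) (f0 : forall x, 0 <= f x).

Let nu (A : set T) : \bar R := \int[mu]_(x in A) f x.

Let nu0 : nu set0 = 0. Proof. exact: integral_set0. Qed.

Let nu_ge0 A : 0 <= nu A. Proof. exact: integral_ge0. Qed.

Let nu_sigma_additive : semi_sigma_additive nu.
Proof. exact: semi_sigma_additive_nng_induced. Qed.

Definition integral_measure : {measure set T -> \bar R} :=
  HB.pack nu (isMeasure.Build _ T R nu nu0 nu_ge0 nu_sigma_additive).

End integral_measure.

(** * [Lambda], its ergodic components and their supports *)

Section main.
Context d (X : measurableType d) (R : realType) (S : X -> X).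
Context (S_bij : bijective S).

Local Notation measF := (@measurable _ (future S)).
Local Notation measB := (@measurable _ (two_sided S)).
Local Notation H psi := (future_outer S psi).
Local Notation meas_funF f := (@measurable_fun _ _ (future S) (\bar R) setT f).

Context (phi : {finite_measure set (future S) -> \bar R}).
Context (Lambda : {measure set (two_sided S) -> \bar R}).
Context (Lambda_inv : @invariant_measure _ (two_sided S) R S Lambda).
Context (LambdaT : Lambda [set: X] = 1).
Context (Z : X -> \bar R) (Z_ge0 : forall x, 0 <= Z x) (mZ : meas_funF Z).
Context (Z_RN : forall A, measF A -> Lambda A = \int[phi]_(x in A) Z x).
Context (I : countType) (lambda : I -> R) (L : I -> probability (two_sided S) R).
Context (lambda_gt0 : forall i, (0 < lambda i)%R).
Context (L_erg : forall i, @ergodic_measure _ (two_sided S) R S (L i)).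
Context (L_dec : forall A, measB A ->
  Lambda A = \esum_(i in [set: I]) ((lambda i)%:E * L i A)).
Context (Xs : I -> set X) (mXs : forall i, measF (Xs i)).
Context (L_Xs : forall i, L i (~` Xs i) = 0).
Context (L_Xs0 : forall i j, i <> j -> L j (Xs i) = 0).
Context (Xs_disj : forall i j, i <> j -> Xs i `&` Xs j = set0).

Let lambdaL_ge0 i A : 0 <= (lambda i)%:E * L i A.
Proof. by rewrite mule_ge0// lee_fin ltW. Qed.

Lemma lambdaL_le i A : measB A -> (lambda i)%:E * L i A <= Lambda A.
Proof.
move=> mA; rewrite L_dec//.
have := @seq_le_esum R I (fun i => (lambda i)%:E * L i A) [:: i] isT.
by rewrite big_seq1.
Qed.

Lemma Lambda_Xs i A : measB A -> A `<=` Xs i ->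
  Lambda A = (lambda i)%:E * L i A.
Proof.
move=> mA AX; rewrite L_dec// (esum_unique (i := i))// => j ji.
rewrite (@subset_measure0 _ _ _ (L j) A (Xs i)) ?mule0//.
  exact: future_two_sided.
by apply: L_Xs0 => ij; apply: ji.
Qed.

Lemma mule_ge0_lt_measurable (f : X -> \bar R) (e : \bar R) : meas_funF f ->
  measF [set x | f x < e * Z x].
Proof.
move=> mf; rewrite -[X in measF X]setTI; apply: measurable_lte => //.
exact: measurable_funeM.
Qed.

(** * Lower bound for the cost of a covering *)

Section lower_bound.
Context (f : X -> \bar R) (mf : meas_funF f) (f0 : forall x, 0 <= f x).
Context (e : I -> \bar R) (e0 : forall i, 0 <= e i).
Context (le_f : forall i, L i [set x | f x < e i * Z x] = 0).

(** On [Xs i], off a set null for [L i], [f] is at least [e i Z], and [Z phi] is [Lambda], which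
    dominates [lambda i L i]. The pieces for distinct [i] are disjoint, so their integrals fit
    together into the one over [B]. *)
Lemma sum_le_integral (B : set X) (s : seq I) : measF B -> uniq s ->
  \sum_(i <- s) (lambda i)%:E * e i * L i B <= \int[phi]_(x in B) f x.
Proof.
move=> mB us; have mBB := future_two_sided mB.
pose N i := [set x | f x < e i * Z x].
have mN i : measF (N i) by exact: mule_ge0_lt_measurable.
pose Y i := B `&` (Xs i `\` N i).
have mY i : measF (Y i) by apply: measurableI => //; exact: measurableD.
have mYB i := future_two_sided (mY i).
have mfD D : measurable_fun (D : set (future S)) f by exact: measurable_funTS.
apply: (@le_trans _ _ (\sum_(i <- s) \int[phi]_(x in Y i) f x)).
  apply: lee_sum => i _.
  have LBY : L i B <= L i (Y i).
    have mC : measB (~` Xs i `|` N i).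
      apply: measurableU; last exact: future_two_sided.
      by apply: measurableC; exact: future_two_sided.
    have C0 : L i (~` Xs i `|` N i) = 0.
      apply: null_set_setU; [|exact: future_two_sided|exact: L_Xs|exact: le_f].
      by apply: measurableC; exact: future_two_sided.
    have <- : L i (Y i `|` (~` Xs i `|` N i)) = L i (Y i) by exact: measureU0.
    apply: le_measure; rewrite ?inE//; first exact: measurableU.
    move=> x Bx; have [Nx|Nx] := pselect (N i x); first by right; right.
    by have [Xx|Xx] := pselect (Xs i x); [left|right; left].
  apply: (@le_trans _ _ (e i * Lambda (Y i))).
    rewrite (muleC (lambda i)%:E) -muleA; apply: lee_wpmul2l => //.
    apply: le_trans (lambdaL_le i (mYB i)).
    by apply: lee_wpmul2l => //; rewrite lee_fin ltW.
  rewrite Z_RN// -ge0_integralZl//; last first.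
    exact: measurable_funTS.
  apply: ge0_le_integral => //.
  - by move=> x _; rewrite mule_ge0.
  - by apply: measurable_funTS; exact: measurable_funeM.
  - by move=> x [_ [_ /negP]]; rewrite -leNgt.
rewrite -ge0_integral_bigsetU//.
- apply: ge0_subset_integral => //; first exact: bigsetU_measurable.
  by rewrite -bigcup_seq => x [i _ []].
- apply/trivIsetP => i j _ _ /eqP ij; apply/seteqP; split=> // x [[_ [Xi _]] [_ [Xj _]]].
  by rewrite -(Xs_disj ij); split.
Qed.

(** [L i] is itself invariant, so the [L i (B n)] sum to at least [L i Q]. Finite families [s] let
    the sum over [i] pass inside the series. *)
Lemma esum_le_cover (Q : set X) (B : nat -> set X) :
  measB Q -> future_covers S Q B ->
  \esum_(i in [set: I]) ((lambda i)%:E * e i * L i Q) <=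
  \sum_(n <oo) \int[phi]_(x in B n) f x.
Proof.
move=> mQ QB; have [mB _] := QB; apply: esum_le_seq => s us.
have c0 i : 0 <= (lambda i)%:E * e i by rewrite mule_ge0// lee_fin ltW.
apply: (@le_trans _ _ (\sum_(i <- s) \sum_(n <oo) (lambda i)%:E * e i * L i (B n))).
  apply: lee_sum => i _; have [inv _] := L_erg i.
  apply: (@le_trans _ _ ((lambda i)%:E * e i * \sum_(n <oo) L i (B n))).
    apply: lee_wpmul2l => //.
    apply: le_trans (future_outer_le_cover (restr_future (L i)) QB).
    by rewrite (@outer_invariantE _ X R S S_bij (restr_future (L i)) (L i) Q inv)//
      ltey_eq fin_num_measure.
  exact: mule_nneseries_le.
rewrite -nneseries_sum; last by move=> i j _; rewrite mule_ge0.
apply: lee_nneseries => [n _ _|n _]; last exact: sum_le_integral.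
by apply: sume_ge0 => i _; rewrite mule_ge0.
Qed.

End lower_bound.

(** * Upper bound for the outer measure by recurrence *)

Section upper_bound.
Context (psi : {measure set (future S) -> \bar R}) (psi_fin : psi setT < +oo).
Context (f : X -> \bar R) (mf : meas_funF f) (f0 : forall x, 0 <= f x).
Context (psiE : forall A, measF A -> psi A = \int[phi]_(x in A) f x).
Context (f_lin : forall x, 0 < Z x -> exists k : nat, f x <= k%:R%:E * Z x).

(** Points whose backward orbit, time 0 included, meets [Z > 0]: the set on which recurrence gives
    information. *)
Definition pos_past : set X := \bigcup_n (iter n S @` [set x | 0 < Z x]).

Local Definition low c : set X := [set x | 0 < Z x /\ f x <= c%:E * Z x].

Let mlow c : measF (low c).
Proof.
apply: measurableI.
  rewrite -[X in measF X]setTI; apply: emeasurable_fun_o_infty => //.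
rewrite -[X in measF X]setTI; apply: measurable_lee => //.
exact: measurable_funeM.
Qed.

Let psi_low c F : (0 <= c)%R -> measF F -> F `<=` low c -> psi F <= c%:E * Lambda F.
Proof.
move=> c0 mF Fl; rewrite psiE// Z_RN// -ge0_integralZl//; last first.
- exact: measurable_funTS.
- apply: ge0_le_integral => //.
  + exact: measurable_funTS.
  + by apply: measurable_funTS; exact: measurable_funeM.
  + by move=> x /Fl [].
Qed.

Let H_low c Q : (0 <= c)%R -> measB Q ->
  H psi (Q `&` past_limsup S (low c)) <= c%:E * Lambda Q.
Proof.
move=> c0 mQ; apply: (future_outer_past_limsup_le S_bij) => //.
  by rewrite LambdaT ltry.
by move=> F; exact: psi_low.
Qed.

(** Absolute continuity with respect to [Lambda]. Up to shifts [pos_past] is the union of the sets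
    [low k]; recurrence replaces each by its limit set, where the outer measure is at most
    [k Lambda]. *)
Lemma future_outer_null Q : measB Q -> Lambda Q = 0 -> H psi (Q `&` pos_past) = 0.
Proof.
move=> mQ Q0; apply/eqP; rewrite eq_le future_outer_ge0 andbT.
have low0 (k n : nat) : H psi (Q `&` iter n S @` low k%:R) = 0.
  apply/eqP; rewrite eq_le future_outer_ge0 andbT.
  rewrite -(image_iter_preimageK S_bij n Q) -(image_iterI S_bij).
  apply: (le_trans (le_future_outer_image S_bij _ _ _)); set Q' := iter n S @^-1` Q.
  have mQ' : measB Q' by exact: two_sided_measurable_preimage.
  have Q'0 : Lambda Q' = 0 by rewrite invariant_preimage_iter.
  pose P := past_limsup S (low k%:R).
  apply: (@le_trans _ _ (H psi (Q' `&` P) + H psi (low k%:R `\` P))).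
    apply: (le_trans _ (future_outerU2 _ _ _)).
    apply: le_future_outer => x [Q'x lx].
    by have [px|px] := pselect (P x); [left|right].
  rewrite future_outer_recurrence ?adde0//; last exact: future_two_sided.
  by apply: le_trans (H_low (ler0n R k) mQ') _; rewrite Q'0 mule0.
apply: (@le_trans _ _ (H psi (\bigcup_n \bigcup_(k : nat) (Q `&` iter n S @` low k%:R)))).
  apply: le_future_outer => x [Qx [n _ [y Zy yx]]].
  have [k fk] := f_lin Zy; exists n => //; exists k => //; split => //.
  by exists y => //; split.
apply: le_trans (future_outer_sigma_subadditive _ _) _.
rewrite eseries0// => n _ _; apply/eqP; rewrite eq_le future_outer_ge0 andbT.
by apply: le_trans (future_outer_sigma_subadditive _ _) _; rewrite eseries0.
Qed.

Context (e : I -> \bar R) (e0 : forall i, 0 <= e i).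
Context (e_low : forall i (c : R), e i < c%:E -> 0 < L i (low c)).

(** For [c > e i] the set [low c] has positive measure, so almost every orbit for [L i] returns to
    it, and the part of [Q] in [Xs i] costs at most [c lambda_i L_i(Q)]; [c] then decreases to
    [e i]. What the limit set and the [Xs i] miss is null for [Lambda]. *)
Lemma future_outer_le_esum Q : measB Q ->
  H psi (Q `&` pos_past) <= \esum_(i in [set: I]) ((lambda i)%:E * e i * L i Q).
Proof.
move=> mQ; have mXB i := future_two_sided (mXs i).
have term i : H psi (Q `&` Xs i `&` pos_past) <= (lambda i)%:E * e i * L i Q.
  have mT : measB (Q `&` Xs i) by exact: measurableI.
  have LT : Lambda (Q `&` Xs i) <= (lambda i)%:E * L i Q.
    rewrite (@Lambda_Xs i)//; apply: lee_wpmul2l; first by rewrite lee_fin ltW.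
    by apply: le_measure; rewrite ?inE.
  (* Settled first because [e i] may be infinite; the right side is then 0 only here. *)
  have [LQ0|LQ0] := eqVneq (L i Q) 0.
    rewrite future_outer_null// ?LQ0 ?mule0//.
    by apply/eqP; rewrite -measure_le0; apply: le_trans LT _; rewrite LQ0 mule0.
  have LQ_gt0 : 0 < L i Q by rewrite lt0e LQ0 measure_ge0.
  case E : (e i) => [r| |]; last by have := e0 i; rewrite E.
    have r0 : (0 <= r)%R by have := e0 i; rewrite E lee_fin.
    rewrite (muleC (lambda i)%:E) -muleA; apply: lee_mulr_gt => //.
      by rewrite fin_numM// fin_num_measure.
    move=> c rc; have c0 : (0 <= c)%R := ltW (le_lt_trans r0 rc).
    have mP : measB (past_limsup S (low c)).
      by apply: measurable_past_limsup => //; exact: future_two_sided.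
    have P0 : L i (~` past_limsup S (low c)) = 0.
      by apply: ergodic_past_limsup => //; apply: e_low; rewrite E lte_fin.
    apply: (@le_trans _ _ (H psi (Q `&` Xs i `&` past_limsup S (low c)) +
        H psi ((Q `&` Xs i `&` ~` past_limsup S (low c)) `&` pos_past))).
      apply: (le_trans _ (future_outerU2 _ _ _)).
      apply: le_future_outer => x [Tx Vx].
      by have [px|px] := pselect (past_limsup S (low c) x); [left|right].
    rewrite (@future_outer_null (_ `&` ~` _)); first last.
    - rewrite (@Lambda_Xs i).
      + rewrite (@subset_measure0 _ _ _ (L i) _ (~` past_limsup S (low c))) ?mule0//.
        * by apply: measurableI => //; exact: measurableC.
        * exact: measurableC.
      + by apply: measurableI => //; exact: measurableC.
      + by move=> x [[]].
    - by apply: measurableI => //; exact: measurableC.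
    rewrite adde0; apply: le_trans (H_low c0 mT) _.
    by apply: lee_wpmul2l => //; rewrite lee_fin.
  by rewrite gt0_muley ?lte_fin// gt0_mulye// leey.
pose N := Q `&` ~` (\bigcup_i Xs i).
have mU : measB (\bigcup_i Xs i) by apply: countable_bigcupT_measurable => //.
have mN : measB N by apply: measurableI => //; exact: measurableC.
have N0 : Lambda N = 0.
  rewrite L_dec// esum1// => i _.
  rewrite (@subset_measure0 _ _ _ (L i) N (~` Xs i)) ?mule0//.
  - by apply: measurableC.
  - by move=> x [_ Ux] Xx; apply: Ux; exists i.
  - exact: L_Xs.
pose A i := Q `&` Xs i `&` pos_past.
apply: (@le_trans _ _ (H psi (N `&` pos_past) + H psi (\bigcup_i A i))).
  apply: (le_trans _ (future_outerU2 _ _ _)).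
  apply: le_future_outer => x [Qx Vx].
  have [[i _ Xx]|Ux] := pselect ((\bigcup_i Xs i) x); last by left.
  by right; exists i.
rewrite future_outer_null// add0e -nneseries_pickle_inv; last first.
  by move=> i; rewrite !mule_ge0// lee_fin ltW.
apply: (@le_trans _ _ (H psi (\bigcup_n oapp A set0 (pickle_inv n)))).
  apply: le_future_outer => x [i _ Ax]; exists (pickle i) => //.
  by rewrite pickleK_inv.
apply: le_trans (future_outer_sigma_subadditive _ _) _.
apply: lee_nneseries => [n _ _|n _]; first exact: future_outer_ge0.
by case: pickle_inv => [i|] /=; [exact: term|rewrite future_outer0].
Qed.

End upper_bound.

(** * The Hausdorff-type infima as outer measures *)

Lemma meas_poweR r : meas_funF (fun x => Z x `^ r).
Proof. exact: (measurableT_comp (measurable_poweR r) mZ). Qed.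

Definition power_measure r : {measure set (future S) -> \bar R} :=
  integral_measure phi (meas_poweR r) (fun x => poweR_ge0 (Z x) r).

Lemma covers_futureE Q A : covers S Q A <->
  exists2 B, future_covers S Q B & A = fun n => iter n S @` B n.
Proof.
split=> [[mA QA]|[B [mB QB] ->]]; last by split=> // n; exists (B n).
have /choice[B AB] n : exists B, measF B /\ iter n S @` B = A n.
  by have [B mB BA] := mA n; exists B.
have AE : A = fun n => iter n S @` B n.
  by apply/funext => n; have [_ <-] := AB n.
exists B => //; split=> [n|]; first by have [] := AB n.
by rewrite AE in QA.
Qed.

Lemma cover_sumE r (B : nat -> set X) :
  cover_sum phi Z r (fun n => iter n S @` B n) = \sum_(n <oo) power_measure r (B n).
Proof.
by apply: eq_eseriesr => n _; rewrite spow_negE preimage_iter_imageK.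
Qed.

Lemma HmeasE r Q : Hmeas phi Z r Q = H (power_measure r) Q.
Proof.
congr (ereal_inf _); apply/seteqP; split=> x.
  by move=> [A /covers_futureE[B QB ->] <-]; rewrite cover_sumE; exists B.
move=> [B QB <-]; rewrite -cover_sumE; exists (fun n => iter n S @` B n) => //.
by apply/covers_futureE; exists B.
Qed.

Lemma mZlt (c : \bar R) : measF [set x | c < Z x].
Proof.
by rewrite -[X in measF X]setTI; apply: measurable_lte.
Qed.

Lemma mZgt (c : \bar R) : measF [set x | Z x < c].
Proof.
by rewrite -[X in measF X]setTI; apply: measurable_lte.
Qed.

Definition eps_inf b a Q (eps : R) : \bar R :=
  ereal_inf [set cover_sum phi Z b A | A in covers_eps phi Z a eps Q].

(** Fewer coverings are admissible as [eps] decreases, so the limit is a supremum. *)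
Lemma Hmeas2E b a Q :
  Hmeas2 phi Z b a Q = ereal_sup [set eps_inf b a Q e | e in [set e | (0 < e)%R]].
Proof.
have -> : [set e : R | (0 < e)%R] = [set` `]0%R, +oo[].
  by apply/seteqP; split=> e /=; rewrite in_itv/= andbT.
apply/cvg_lim => //.
have := @nonincreasing_at_right_cvge R (eps_inf b a Q) 0%R +oo%O.
apply => // e1 e2 _ _ e12; apply: ereal_inf_le_tmp => _ [A [QA Ae] <-].
exists A => //; split => //; apply: lt_le_trans Ae _.
by rewrite leeD2l// lee_fin.
Qed.

Lemma eps_inf_le b a Q eps B : future_covers S Q B ->
  \sum_(n <oo) power_measure a (B n) < Hmeas phi Z a Q + eps%:E ->
  eps_inf b a Q eps <= \sum_(n <oo) power_measure b (B n).
Proof.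
move=> QB Beps; apply: ereal_inf_lbound; exists (fun n => iter n S @` B n).
  by split; [apply/covers_futureE; exists B|rewrite cover_sumE].
by rewrite cover_sumE.
Qed.

Lemma le_eps_inf b a Q eps x :
  (forall B, future_covers S Q B ->
    \sum_(n <oo) power_measure a (B n) < Hmeas phi Z a Q + eps%:E ->
    x <= \sum_(n <oo) power_measure b (B n)) ->
  x <= eps_inf b a Q eps.
Proof.
move=> xB; apply: le_ereal_inf_tmp => _ [A [/covers_futureE[B QB ->] Ae] <-].
by rewrite cover_sumE; apply: xB => //; rewrite -cover_sumE.
Qed.

(** * Duality for the constrained infimum *)

Section duality.
Context (dir : bool) (E : I -> \bar R) (bE : forall i, range_bound dir (E i)).

Let good i x := [/\ 0 < Z x, Z x < +oo & range_side dir (E i) (Z x)].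

Context (Z_good : forall i, L i [set x | ~ good i x] = 0).
Context (Z_near : forall i (z0 : R), (0 < z0)%R -> near_side dir z0%:E (E i) ->
  0 < L i [set x | near_side dir z0%:E (Z x)]).

(** [Z ^ (r - 1)] is the ratio of the densities of [Z ^ r phi] and [Lambda]; [kap r i] is its value
    at the essential bound seen by [L i]. *)
Local Notation kap r i := (epow (E i) (r - 1)).

Let mbad i : measF [set x | ~ good i x].
Proof.
have -> : [set x | ~ good i x] = ~` ([set x | 0 < Z x] `&` [set x | Z x < +oo]
    `&` [set x | range_side dir (E i) (Z x)]).
  by apply/seteqP; split=> x /= h h'; apply: h; move: h'; [case=> [[]]|case].
apply: measurableC; apply: measurableI.
  by apply: measurableI; [exact: mZlt|exact: mZgt].
rewrite -[X in measF X]setTI /range_side.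
by case: dir; apply: measurable_lee.
Qed.

Let poweR_fin (z r : R) : (z%:E `^ r = (z `^ r)%:E).
Proof. exact: poweR_EFin. Qed.

Let powR_pred (z r : R) : (0 < z)%R -> (z `^ r = z * z `^ (r - 1))%R.
Proof.
move=> z0; rewrite -{2}(powRr1 (ltW z0)) -powRD ?subrKC//.
by rewrite (gt_eqF z0) implybT.
Qed.

Let good_fin i x : good i x -> exists z : R,
  [/\ (0 < z)%R, Z x = z%:E & range_side dir (E i) z%:E].
Proof. by case; case: (Z x) => [z| |]//; rewrite lte_fin => ? _ ?; exists z. Qed.

Let null_of_good i (P : set X) : measF P -> (forall x, good i x -> ~ P x) ->
  L i P = 0.
Proof.
move=> mP gP; apply: subset_measure0 (Z_good i); try exact: future_two_sided.
by move=> x Px gx; exact: (gP x gx).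
Qed.

Let pos_of_near i (z0 : R) (P : set X) : measF P -> (0 < z0)%R ->
  near_side dir z0%:E (E i) ->
  (forall x, good i x -> near_side dir z0%:E (Z x) -> P x) -> 0 < L i P.
Proof.
move=> mP z00 z0E gP; apply: (lt_le_trans (Z_near z00 z0E)).
have mbad' := future_two_sided (mbad i); have mP' := future_two_sided mP.
have <- : L i (P `|` [set x | ~ good i x]) = L i P.
  by apply: measureU0 => //; exact: Z_good.
apply: le_measure; rewrite ?inE; last 2 first.
- exact: measurableU.
- move=> x Nx; have [gx|gx] := pselect (good i x); last by right.
  by left; exact: gP.
by apply: future_two_sided; rewrite /near_side; case: dir; [exact: mZlt|exact: mZgt].
Qed.

Section exponents.
Context (a b : R) (a0 : (0 <= a)%R) (b0 : (0 <= b)%R).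
Context (aside : exponent_side dir (a - 1)).

Let kapa_fin i : kap a i \is a fin_num.
Proof. exact: epow_extremum. Qed.

Definition mixed (s t : R) (x : X) : \bar R := s%:E * Z x `^ a + t%:E * Z x `^ b.

Lemma mixed_ge0 s t x : (0 <= s)%R -> (0 <= t)%R -> 0 <= mixed s t x.
Proof.
by move=> s0 t0; rewrite adde_ge0// mule_ge0 ?lee_fin ?poweR_ge0.
Qed.

Lemma meas_mixed s t : meas_funF (mixed s t).
Proof.
by apply: emeasurable_funD; apply: measurable_funeM; exact: meas_poweR.
Qed.

Lemma mixedE s t A : (0 <= s)%R -> (0 <= t)%R -> measF A ->
  \int[phi]_(x in A) mixed s t x =
  s%:E * power_measure a A + t%:E * power_measure b A.
Proof.
move=> s0 t0 mA; rewrite ge0_integralD//.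
- by rewrite !ge0_integralZl// ?lee_fin//; try (by move=> *; exact: poweR_ge0);
    apply: measurable_funTS; exact: meas_poweR.
- by move=> x _; rewrite mule_ge0 ?lee_fin ?poweR_ge0.
- by apply: measurable_funTS; apply: measurable_funeM; exact: meas_poweR.
- by move=> x _; rewrite mule_ge0 ?lee_fin ?poweR_ge0.
- by apply: measurable_funTS; apply: measurable_funeM; exact: meas_poweR.
Qed.

Lemma mixed_low i t c : (0 <= t)%R -> kap a i + t%:E * kap b i < c%:E ->
  0 < L i [set x | 0 < Z x /\ mixed 1 t x <= c%:E * Z x].
Proof.
move=> t0 /(two_powers_upper (bE i) aside t0) [z0 [z00 z0E z0P]].
apply: (pos_of_near _ z00 z0E).
  apply: measurableI; first exact: mZlt.
  rewrite -[X in measF X]setTI; apply: measurable_lee => //.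
    exact: meas_mixed.
  exact: measurable_funeM.
move=> x gx; have [z [zpos Zz zE]] := good_fin gx; rewrite /= /mixed Zz.
move=> /(z0P z zpos) /(_ zE) zc; split; first by rewrite lte_fin.
rewrite !poweR_fin -!EFinM -EFinD lee_fin mul1r (powR_pred a zpos) (powR_pred b zpos) mulrCA -mulrDr.
by rewrite mulrC ler_pM2r.
Qed.

Lemma mixed_lin t x : (0 <= t)%R -> 0 < Z x ->
  exists k : nat, mixed 1 t x <= k%:R%:E * Z x.
Proof.
rewrite /mixed; case: (Z x) => [z| |]// t0 z0; last first.
  by exists 1%N; rewrite [leRHS]gt0_muley ?leey// lte_fin ltr01.
rewrite lte_fin in z0; pose v := (1 * z `^ a + t * z `^ b)%R.
have v0 : (0 <= v / z)%R.
  by rewrite divr_ge0 ?(ltW z0)// addr_ge0 ?mulr_ge0 ?powR_ge0.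
exists (Num.bound (v / z)); rewrite !poweR_fin -!EFinM -EFinD lee_fin.
by rewrite -ler_pdivrMr//; apply/ltW; have := archi_boundP v0.
Qed.

Lemma single_null i : L i [set x | Z x `^ a < kap a i * Z x] = 0.
Proof.
apply: null_of_good; first by apply: mule_ge0_lt_measurable; exact: meas_poweR.
move=> x gx; have [z [zpos Zz zE]] := good_fin gx; rewrite /= Zz.
rewrite poweR_fin -(fineK (kapa_fin i)) -EFinM lte_fin (powR_pred a zpos) mulrC.
rewrite ltr_pM2r// -lte_fin fineK// ltNge (epow_extremum_le (bE i))//.
Qed.

(** Stated for all [K] beyond [K0] because finitely many indices will share one [K]; enlarging [K]
    is harmless, as [kap a i] bounds [Z ^ (a - 1)] from below. *)
Lemma mixed_null i w : (0 <= w)%R -> w%:E < kap b i \/ w = 0%R ->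
  exists2 K0, (0 <= K0)%R & forall K, (K0 <= K)%R ->
    L i [set x | mixed K 1 x < (K * fine (kap a i) + w)%:E * Z x] = 0.
Proof.
move=> w0 wk; have [K0 K00 K0P] : exists2 K0, (0 <= K0)%R &
    forall z, (0 < z)%R -> range_side dir (E i) z%:E ->
    (K0 * fine (kap a i) + w <= K0 * z `^ (a - 1) + z `^ (b - 1))%R.
  have [wk'|->] := wk; first exact: two_powers_lower.
  by exists 0%R => // z _ _; rewrite !mul0r !add0r powR_ge0.
exists K0 => // K KK; apply: null_of_good.
  by apply: mule_ge0_lt_measurable; exact: meas_mixed.
move=> x gx; have [z [zpos Zz zE]] := good_fin gx; rewrite /= /mixed Zz.
rewrite !poweR_fin -!EFinM -EFinD lte_fin mul1r (powR_pred a zpos) (powR_pred b zpos) mulrCA -mulrDr.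
apply/negP; rewrite -leNgt [leLHS]mulrC ler_pM2l//.
have := K0P z zpos zE.
have : (fine (kap a i) <= z `^ (a - 1))%R.
  by rewrite -lee_fin fineK// (epow_extremum_le (bE i)).
have : (0 <= K - K0)%R by rewrite subr_ge0.
nra.
Qed.

Let G r Q := \esum_(i in [set: I]) ((lambda i)%:E * kap r i * L i Q).

Lemma le_Hmeas Q : measB Q -> G a Q <= Hmeas phi Z a Q.
Proof.
move=> mQ; rewrite HmeasE; apply: le_ereal_inf_tmp => _ [B QB <-].
apply: (@esum_le_cover (fun x => Z x `^ a)) => //.
- exact: meas_poweR.
- by move=> x; exact: poweR_ge0.
- by move=> i; exact: epow_ge0.
- exact: single_null.
Qed.

Section mixed_upper.
Context (t : R) (t0 : (0 <= t)%R).

Definition mixed_measure : {measure set (future S) -> \bar R} :=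
  integral_measure phi (meas_mixed 1 t) (fun x => mixed_ge0 x ler01 t0).

Lemma mixed_outer_le Q : power_measure a setT < +oo ->
  t%:E * power_measure b setT < +oo -> measB Q ->
  H mixed_measure (Q `&` ~` pos_past) = 0 ->
  H mixed_measure Q <= \esum_(i in [set: I])
    ((lambda i)%:E * (kap a i + t%:E * kap b i) * L i Q).
Proof.
move=> fa fb mQ QN.
have fin : mixed_measure setT < +oo.
  rewrite [X in X < _](_ : _ = \int[phi]_(x in setT) mixed 1 t x)//.
  by rewrite mixedE// mul1e lte_add_pinfty.
have mP : measB pos_past.
  apply: bigcupT_measurable => n; apply: two_sided_measurable_image => //.
  by apply: future_two_sided; exact: mZlt.
rewrite (future_outerID S_bij fin mQ mP) QN adde0.
apply: (@future_outer_le_esum _ fin (mixed 1 t)) => //.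
- exact: meas_mixed.
- by move=> x; exact: mixed_ge0.
- by move=> x; exact: mixed_lin.
- by move=> i; rewrite adde_ge0 ?mule_ge0 ?epow_ge0 ?lee_fin.
- by move=> i c; exact: mixed_low.
Qed.

End mixed_upper.

Lemma Hmeas_le Q : power_measure a setT < +oo -> measB Q ->
  H (power_measure a) (Q `&` ~` pos_past) = 0 -> Hmeas phi Z a Q <= G a Q.
Proof.
move=> fa mQ QN; rewrite HmeasE.
have mP : measB pos_past.
  apply: bigcupT_measurable => n; apply: two_sided_measurable_image => //.
  by apply: future_two_sided; exact: mZlt.
rewrite (future_outerID S_bij fa mQ mP) QN adde0.
(* The single power is the mixed one of weight 0, and [0 * kap b i] is 0 even for infinite
   [kap b i]. *)
have m0 x : mixed 1 0 x = Z x `^ a by rewrite /mixed mul1e mul0e adde0.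
apply: (@future_outer_le_esum _ fa (fun x => Z x `^ a)) => //.
- exact: meas_poweR.
- by move=> x; exact: poweR_ge0.
- by move=> x /(mixed_lin (lexx 0%R)); rewrite m0.
- by move=> i; exact: epow_ge0.
- move=> i c kc; have := @mixed_low i 0%R c (lexx 0%R).
  by rewrite mul0e adde0 => /(_ kc); under eq_set do rewrite m0.
Qed.

Section lower.
Context (Q : set X) (mQ : measB Q).
Context (fa : power_measure a setT < +oo).
Context (Qa : H (power_measure a) (Q `&` ~` pos_past) = 0).

Let Ha := Hmeas phi Z a Q.

Let Ha_fin : Ha \is a fin_num.
Proof. by rewrite /Ha HmeasE; exact: (future_outer_fin_num (psi := power_measure a)). Qed.

(** For [K Z^a + Z^b] every covering costs at least [K G a Q + W], and [G a Q] is the unconstrained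
    infimum for [Z^a]. The constraint exceeds that infimum by [eps] only, so at least [W - K eps]
    falls to [Z^b]; [K] stays fixed while [eps] tends to 0. *)
Lemma weighted_le_Hmeas2 (s : seq I) (w : I -> R) : uniq s ->
  (forall i, 0 <= w i)%R -> (forall i, (w i)%:E < kap b i \/ w i = 0%R) ->
  \sum_(i <- s) (lambda i)%:E * (w i)%:E * L i Q <= Hmeas2 phi Z b a Q.
Proof.
move=> us w0 wk.
have /choice[K0 K0P] i : exists K0, (0 <= K0)%R /\ forall K, (K0 <= K)%R ->
    L i [set x | mixed K 1 x < (K * fine (kap a i) + w i)%:E * Z x] = 0.
  by have [K K1 K2] := mixed_null (w0 i) (wk i); exists K.
(* A sum of nonnegative numbers is at least each of them: one [K] for all of [s]. *)
pose K := (\sum_(i <- s) K0 i)%R.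
have K_ge0 : (0 <= K)%R by apply: sumr_ge0 => i _; have [] := K0P i.
have K0K i : i \in s -> (K0 i <= K)%R.
  move=> si; rewrite /K (big_rem i)//= lerDl; apply: sumr_ge0 => j _.
  by have [] := K0P j.
(* Outside [s] the weight is 0, but the term [K kap a i] stays: all of [G a Q] is needed to match
   the constraint. *)
pose w' i := if i \in s then w i else 0%R.
pose e i := (K * fine (kap a i) + w' i)%:E.
have w'0 i : (0 <= w' i)%R by rewrite /w'; case: ifP.
have ka0 i : (0 <= fine (kap a i))%R by rewrite fine_ge0// epow_ge0.
have e0 i : 0 <= e i by rewrite lee_fin addr_ge0// mulr_ge0.
have le_e i : L i [set x | mixed K 1 x < e i * Z x] = 0.
  rewrite /e /w'; case: ifP => [si|_]; first by have [_] := K0P i; apply; exact: K0K.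
  have me c : measB [set x | mixed K 1 x < c * Z x].
    by apply: future_two_sided; apply: mule_ge0_lt_measurable; exact: meas_mixed.
  apply: null_of_good; first by apply: mule_ge0_lt_measurable; exact: meas_mixed.
  move=> x gx; have [z [zpos Zz zE]] := good_fin gx; rewrite /= /mixed Zz.
  rewrite !poweR_fin -!EFinM -EFinD lte_fin mul1r addr0 (powR_pred a zpos).
  apply/negP; rewrite -leNgt -[leLHS]addr0; apply: lerD; last exact: powR_ge0.
  rewrite mulrAC -mulrA ler_wpM2l// ler_pM2l//.
  by rewrite -lee_fin fineK// (epow_extremum_le (bE i)).
set W := \sum_(i <- s) _.
have W_fin : W \is a fin_num.
  rewrite /W sum_fin_num; apply/allP => _ /mapP[i _ ->].
  by rewrite inE; apply: fin_numM => //; exact: fin_num_measure.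
have step eps : (0 < eps)%R -> W - (K * eps)%:E <= eps_inf b a Q eps.
  move=> eps0; apply: le_eps_inf => B QB sumB.
  have := esum_le_cover (meas_mixed K 1) (fun x => mixed_ge0 x K_ge0 ler01) e0 le_e mQ QB.
  have [mB _] := QB.
  under [X in _ <= X -> _]eq_eseriesr do rewrite mixedE//.
  rewrite nneseriesD; last 2 first.
  - by move=> *; rewrite mule_ge0 ?lee_fin// measure_ge0.
  - by move=> *; rewrite mule_ge0 ?lee_fin// measure_ge0.
  rewrite nneseriesZl; last by move=> *; exact: measure_ge0.
  under [X in _ <= _ + X -> _]eq_eseriesr do rewrite mul1e.
  move=> le1.
  have le2 : K%:E * Ha + W <= \esum_(i in [set: I]) ((lambda i)%:E * e i * L i Q).
    have -> : \esum_(i in [set: I]) ((lambda i)%:E * e i * L i Q) =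
        K%:E * G a Q + \esum_(i in [set: I]) ((lambda i)%:E * (w' i)%:E * L i Q).
      rewrite -esumZl//; last by move=> i; rewrite !mule_ge0 ?lee_fin ?epow_ge0// ltW.
      rewrite -esumD.
      + apply: eq_esum => i _; rewrite /e EFinD EFinM (fineK (kapa_fin i)).
        rewrite ge0_muleDr ?ge0_muleDl ?mule_ge0 ?lee_fin ?epow_ge0 ?(ltW (lambda_gt0 i))//.
        by rewrite !muleA (muleC K%:E).
      + by move=> i _; rewrite !mule_ge0 ?lee_fin ?epow_ge0// ltW.
      + by move=> i _; rewrite !mule_ge0 ?lee_fin// ltW.
    apply: leeD; first by apply: lee_wpmul2l; [rewrite lee_fin|exact: Hmeas_le].
    apply: le_trans (seq_le_esum _ us); rewrite /W [leLHS]big_seq [leRHS]big_seq.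
    by apply: lee_sum => i si; rewrite /w' si.
  have le3 : K%:E * (\sum_(n <oo) power_measure a (B n)) <= K%:E * (Ha + eps%:E).
    by apply: lee_wpmul2l; [rewrite lee_fin|exact: ltW].
  have : K%:E * Ha + W <= K%:E * (Ha + eps%:E) + \sum_(n <oo) power_measure b (B n).
    by apply: (le_trans (le_trans le2 le1)); rewrite leeD2r.
  exact: lee_cancel_excess.
rewrite Hmeas2E; apply/lee_addgt0Pr => eta eta0.
have K1 : (0 < K + 1)%R by rewrite ltr_wpDl.
(* Makes [K eps <= eta]; the added 1 covers [K = 0]. *)
pose eps := (eta / (K + 1))%R; have eps0 : (0 < eps)%R by rewrite divr_gt0.
apply: (@le_trans _ _ (eps_inf b a Q eps + eta%:E)); last first.
  by rewrite leeD2r//; apply: ereal_sup_ubound; exists eps.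
rewrite -leeBlDr//; apply: le_trans (step _ eps0); rewrite leeD2l//.
rewrite lee_fin lerN2 /eps mulrA ler_pdivrMr// mulrC ler_pM2l// lerDl//.
Qed.

Lemma le_Hmeas2 : G b Q <= Hmeas2 phi Z b a Q.
Proof.
apply: esum_le_seq => s us.
have c_ge0 i : 0 <= (lambda i)%:E * L i Q by exact: lambdaL_ge0.
have E1 (k : I -> \bar R) : \sum_(i <- s) (lambda i)%:E * k i * L i Q =
    \sum_(i <- s) ((lambda i)%:E * L i Q) * k i.
  by apply: eq_bigr => i _; rewrite muleAC.
rewrite E1 -[leLHS]adde0; apply: lee_sum_approx => //.
- by move=> i; apply: fin_numM => //; exact: fin_num_measure.
- by move=> i; exact: epow_ge0.
- move=> w w0 wk; rewrite adde0 -(E1 (fun i => (w i)%:E)).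
  exact: weighted_le_Hmeas2.
Qed.

End lower.

(** A covering nearly optimal for [Z^a + t Z^b] is admissible for the constrained problem: its [Z^a]
    cost cannot fall below the infimum, which leaves at most [g + eta] to [Z^b]. *)
Lemma Hmeas2_le Q : measB Q -> power_measure a setT < +oo ->
  power_measure b setT < +oo ->
  (forall t (t0 : (0 <= t)%R), (0 < t)%R ->
    H (mixed_measure t0) (Q `&` ~` pos_past) = 0) ->
  Hmeas2 phi Z b a Q <= G b Q.
Proof.
move=> mQ fa fb QN; rewrite Hmeas2E; apply: ge_ereal_sup => _ [eps /= eps0 <-].
have Gb0 : 0 <= G b Q.
  by apply: esum_ge0 => i _; rewrite !mule_ge0 ?lee_fin ?epow_ge0// ltW.
have Ha_fin : Hmeas phi Z a Q \is a fin_num.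
  by rewrite HmeasE; exact: (future_outer_fin_num (psi := power_measure a)).
case Gg : (G b Q) Gb0 => [g| |]// g0; last by rewrite leey.
rewrite lee_fin in g0; apply/lee_addgt0Pr => eta eta0.
have ge0' : (0 < g + eta)%R by rewrite ltr_wpDl.
(* Makes [t (g + eta) = eps], the excess that the constraint tolerates; [eta] keeps the divisor
   positive when [g = 0]. *)
pose t := (eps / (g + eta))%R; have t_gt0 : (0 < t)%R by rewrite divr_gt0.
have t0 := ltW t_gt0.
have tb : t%:E * power_measure b setT < +oo.
  by rewrite lte_mul_pinfty ?lee_fin.
have Hmix : H (mixed_measure t0) Q < Hmeas phi Z a Q + (t * (g + eta))%:E.
  have le1 := mixed_outer_le fa tb mQ (QN _ t0 t_gt0).
  apply: (le_lt_trans le1).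
  have -> : \esum_(i in [set: I]) ((lambda i)%:E * (kap a i + t%:E * kap b i) * L i Q) =
      G a Q + t%:E * G b Q.
    rewrite -esumZl//; last by move=> i; rewrite !mule_ge0 ?lee_fin ?epow_ge0// ltW.
    rewrite -esumD.
    + apply: eq_esum => i _.
      rewrite ge0_muleDr ?ge0_muleDl ?mule_ge0 ?lee_fin ?epow_ge0 ?(ltW (lambda_gt0 i))//.
      by rewrite !muleA (muleC t%:E).
    + by move=> i _; rewrite !mule_ge0 ?lee_fin ?epow_ge0// ltW.
    + by move=> i _; rewrite !mule_ge0 ?lee_fin ?epow_ge0// ltW.
  apply: (@le_lt_trans _ _ (Hmeas phi Z a Q + t%:E * g%:E)).
    by rewrite Gg leeD2r// le_Hmeas.
  rewrite -(fineK Ha_fin) -EFinM -!EFinD lte_fin mulrDr addrA ltrDl mulr_gt0//.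
have [B QB sumB] := future_outer_lt Hmix; have [mB _] := QB.
have sumE : \sum_(n <oo) mixed_measure t0 (B n) =
    \sum_(n <oo) power_measure a (B n) + t%:E * \sum_(n <oo) power_measure b (B n).
  rewrite -nneseriesZl; last by move=> *; exact: measure_ge0.
  rewrite -nneseriesD; last 2 first.
  - by move=> *; exact: measure_ge0.
  - by move=> *; rewrite mule_ge0 ?lee_fin// measure_ge0.
  apply: eq_eseriesr => n _.
  rewrite [LHS](_ : _ = \int[phi]_(x in B n) mixed 1 t x)//.
  by rewrite mixedE// mul1e.
have leA : Hmeas phi Z a Q <= \sum_(n <oo) power_measure a (B n).
  by rewrite HmeasE; exact: future_outer_le_cover.
move: sumB leA; rewrite sumE -(fineK Ha_fin) -EFinD => sumB leA.
have [||ltA leB] := split_excess _ _ t_gt0 leA sumB.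
- by apply: nneseries_ge0 => *; exact: measure_ge0.
- by apply: nneseries_ge0 => *; exact: measure_ge0.
rewrite -EFinD; apply: le_trans leB; apply: eps_inf_le => //.
apply: (lt_le_trans ltA).
by rewrite EFinD fineK// /t divfK// gt_eqF.
Qed.

Lemma Hmeas2_formula Q : measB Q -> power_measure a setT < +oo ->
  power_measure b setT < +oo ->
  H (power_measure a) (Q `&` ~` pos_past) = 0 ->
  (forall t (t0 : (0 <= t)%R), (0 < t)%R ->
    H (mixed_measure t0) (Q `&` ~` pos_past) = 0) ->
  Hmeas2 phi Z b a Q = G b Q.
Proof.
move=> mQ fa fb Qa Qmix; apply/eqP; rewrite eq_le Hmeas2_le//=.
exact: le_Hmeas2.
Qed.

End exponents.
End duality.

(** * Zeros, infinities and essential bounds of [Z] *)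

Lemma measurable_pos_past : measB pos_past.
Proof.
apply: bigcupT_measurable => n; apply: two_sided_measurable_image => //.
by apply: future_two_sided; exact: mZlt.
Qed.

Lemma pos_pastC_sub : ~` pos_past `<=` [set x | Z x = 0].
Proof.
move=> x Vx; apply/eqP; rewrite eq_le Z_ge0 andbT leNgt; apply/negP => Zx.
by apply: Vx; exists 0%N => //; exists x.
Qed.

Lemma measurable_Z0 : measF [set x | Z x = 0].
Proof.
suff -> : [set x | Z x = 0] = ~` [set x | 0 < Z x].
  by apply: measurableC; exact: mZlt.
by apply/seteqP; split=> x /=; [move=> ->; rewrite ltxx|
  move/negP; rewrite -leNgt => Zx; apply/eqP; rewrite eq_le Zx Z_ge0].
Qed.

Lemma Lambda_null_L i A : measB A -> Lambda A = 0 -> L i A = 0.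
Proof.
move=> mA A0; have := lambdaL_le i mA; rewrite A0 => le0.
have : (lambda i)%:E * L i A == 0 by rewrite eq_le le0 lambdaL_ge0.
by rewrite mule_eq0 eqe gt_eqF//= => /eqP.
Qed.

Lemma Lambda_Z0 : Lambda [set x | Z x = 0] = 0.
Proof. by rewrite Z_RN; [exact: integral0_eq|exact: measurable_Z0]. Qed.

Lemma L_pos_pastC i : L i (~` pos_past) = 0.
Proof.
apply: (Lambda_null_L _ (measurableC measurable_pos_past)).
apply: subset_measure0 Lambda_Z0; last exact: pos_pastC_sub.
- exact: measurableC measurable_pos_past.
- exact: future_two_sided measurable_Z0.
Qed.

Lemma L_pos_past i Q : measB Q -> L i (Q `&` pos_past) = L i Q.
Proof.
move=> mQ; have mP := measurable_pos_past.
have -> : L i Q = L i (Q `\` pos_past) + L i (Q `&` pos_past).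
  exact: measureDI.
rewrite (@subset_measure0 _ _ _ (L i) (Q `\` pos_past) (~` pos_past)) ?add0e//.
- exact: measurableD.
- exact: measurableC.
- exact: L_pos_pastC.
Qed.

Lemma phi_Zy : phi [set x | Z x = +oo] = 0.
Proof.
have mA : measF [set x | Z x = +oo].
  suff -> : [set x | Z x = +oo] = ~` [set x | Z x < +oo].
    by apply: measurableC; exact: mZgt.
  by apply/seteqP; split=> x /=; [move=> ->; rewrite ltxx|
    move/negP; rewrite -leNgt leye_eq => /eqP].
apply/eqP/negPn/negP => phiA.
have : \int[phi]_(x in [set x | Z x = +oo]) Z x = +oo.
  rewrite (eq_integral (cst +oo)); last by move=> x; rewrite inE.
  by rewrite integral_cst// gt0_mulye// lt0e phiA measure_ge0.
rewrite -Z_RN// => A_y.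
have : Lambda [set x | Z x = +oo] <= Lambda [set: X].
  by apply: le_measure; rewrite ?inE//; exact: future_two_sided.
by rewrite A_y LambdaT leye_eq.
Qed.

Lemma phi_null_Lambda A : measF A -> phi A = 0 -> Lambda A = 0.
Proof.
by move=> mA A0; rewrite Z_RN// null_set_integral//; exact: measurable_funTS.
Qed.

Lemma L_Z_fin i : \forall x \ae L i, 0 < Z x /\ Z x < +oo.
Proof.
have mA : measF [set x | Z x = 0] := measurable_Z0.
have mB : measF [set x | Z x = +oo].
  suff -> : [set x | Z x = +oo] = ~` [set x | Z x < +oo].
    by apply: measurableC; exact: mZgt.
  by apply/seteqP; split=> x /=; [move=> ->; rewrite ltxx|
    move/negP; rewrite -leNgt leye_eq => /eqP].
have mA' := future_two_sided mA; have mB' := future_two_sided mB.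
exists ([set x | Z x = 0] `|` [set x | Z x = +oo]); split.
- exact: measurableU.
- apply: null_set_setU => //; apply: Lambda_null_L => //; first exact: Lambda_Z0.
  by apply: phi_null_Lambda => //; exact: phi_Zy.
- move=> x /= nZ; have [->|Zn0] := eqVneq (Z x) 0; first by left.
  right; apply/eqP; rewrite -leye_eq leNgt; apply/negP => Zy; apply: nZ; split => //.
  by rewrite lt0e Zn0 Z_ge0.
Qed.

Definition Z_bound (dir : bool) i := if dir then ess_sup (L i) Z else ess_inf (L i) Z.

Let L_proper i : ProperFilter (almost_everywhere (L i)).
Proof.
apply: ae_properfilter_algebraOfSetsType.
by rewrite [ltRHS](_ : _ = 1) ?lte01//; exact: probability_setT.
Qed.

Lemma Z_bound_range dir i : range_bound dir (Z_bound dir i).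
Proof.
have FF := L_proper i.
case: dir => /=.
  rewrite ltNge; apply/negP => /ess_supP le0; near (almost_everywhere (L i)) => x.
  have [Zx _] : 0 < Z x /\ Z x < +oo by near: x; exact: L_Z_fin.
  have : Z x <= 0 by near: x.
  by rewrite leNgt Zx.
apply/andP; split; first by apply/ess_infP; apply: nearW => x; exact: Z_ge0.
rewrite ltey; apply/negP => /eqP Ey; near (almost_everywhere (L i)) => x.
have [_ Zx] : 0 < Z x /\ Z x < +oo by near: x; exact: L_Z_fin.
have : ess_inf (L i) Z <= Z x by near: x; exact: ess_inf_le.
by rewrite Ey leye_eq => /eqP Zy; rewrite Zy ltxx in Zx.
Unshelve. all: by end_near. Qed.

Lemma Z_bound_good dir i : L i [set x | ~ [/\ 0 < Z x, Z x < +oo &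
  range_side dir (Z_bound dir i) (Z x)]] = 0.
Proof.
have mP : measB [set x | ~ [/\ 0 < Z x, Z x < +oo &
    range_side dir (Z_bound dir i) (Z x)]].
  apply: future_two_sided.
  have -> : [set x | ~ [/\ 0 < Z x, Z x < +oo &
      range_side dir (Z_bound dir i) (Z x)]] = ~` ([set x | 0 < Z x]
      `&` [set x | Z x < +oo] `&` [set x | range_side dir (Z_bound dir i) (Z x)]).
    by apply/seteqP; split=> x /= h h'; apply: h; move: h'; [case=> [[]]|case].
  apply: measurableC; apply: measurableI.
    by apply: measurableI; [exact: mZlt|exact: mZgt].
  rewrite -[X in measF X]setTI /range_side.
  by case: dir; apply: measurable_lee.
apply/(negligibleP _ mP).
have : \forall x \ae L i, [/\ 0 < Z x, Z x < +oo & range_side dir (Z_bound dir i) (Z x)].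
  have FF := L_proper i.
  have h : \forall x \ae L i, range_side dir (Z_bound dir i) (Z x).
    by case: dir {mP}; [exact: ess_sup_ge|exact: ess_inf_le].
  by apply: filterS2 h (L_Z_fin i) => x ? [].
by [].
Qed.

Lemma Z_bound_near dir i (z0 : R) : near_side dir z0%:E (Z_bound dir i) ->
  0 < L i [set x | near_side dir z0%:E (Z x)].
Proof.
move=> z0E; rewrite lt0e measure_ge0 andbT; apply/eqP => L0.
have mP : measB [set x | near_side dir z0%:E (Z x)].
  by apply: future_two_sided; case: (dir); [exact: mZlt|exact: mZgt].
have : \forall x \ae L i, ~ near_side dir z0%:E (Z x).
  have /(negligibleP _ mP) := L0.
  by rewrite /almost_everywhere /prop_near1 /nbhs /= => h; apply: negligibleS h => x /= /contrapT.
have FF := L_proper i; case: dir z0E {mP L0} => /= z0E h.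
  have : ess_sup (L i) Z <= z0%:E.
    by apply/ess_supP; apply: filterS h => x /negP; rewrite -leNgt.
  by rewrite leNgt z0E.
have : z0%:E <= ess_inf (L i) Z.
  by apply/ess_infP; apply: filterS h => x /negP; rewrite -leNgt.
by rewrite leNgt z0E.
Qed.

(** * From the densities of the components to [Z] *)

Section conditional_densities.
Context (Zi : I -> X -> \bar R) (mZi : forall i, meas_funF (Zi i)).
Context (Zi_RN : forall i A, measF A -> L i A = \int[phi]_(x in A) Zi i x).

(** On [Xs i] the measures [Lambda] and [lambda i L i] agree, hence so do their densities, almost
    everywhere for [phi]. The exceptional set is null for [L i] too, as [L i] has a density. *)
Lemma Z_Zi i : \forall x \ae L i, Z x = (lambda i)%:E * Zi i x.
Proof.
have mX : measF (Xs i) by exact: mXs.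
have Zi_int A : measF A -> phi.-integrable (A : set (future S)) (Zi i).
  move=> mA; apply/integrableP; split; first exact: measurable_funTS.
  apply/abse_integralP => //; first exact: measurable_funTS.
  rewrite -Zi_RN// gee0_abs//.
  by rewrite ltey_eq fin_num_measure//; exact: future_two_sided.
have Z_int : phi.-integrable (Xs i : set (future S)) Z.
  apply/integrableP; split; first exact: measurable_funTS.
  apply/abse_integralP => //; first exact: measurable_funTS.
  rewrite -Z_RN// gee0_abs//; apply: (@le_lt_trans _ _ (Lambda [set: X])).
    by apply: le_measure; rewrite ?inE//; exact: future_two_sided.
  by rewrite LambdaT ltry.
have : ae_eq phi (Xs i : set (future S)) Z (fun x => (lambda i)%:E * Zi i x).
  apply: integral_ae_eq => //.
    by apply: measurable_funTS; exact: measurable_funeM.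
  move=> A AX mA; rewrite integralZl//; last exact: Zi_int.
  by rewrite -Z_RN// -Zi_RN// (@Lambda_Xs i)//; exact: future_two_sided.
move=> [N [mN N0 NP]].
exists (N `|` ~` Xs i); split.
- by apply: measurableU; [|apply: measurableC]; exact: future_two_sided.
- apply: null_set_setU.
  + exact: future_two_sided.
  + by apply: measurableC; exact: future_two_sided.
  + transitivity (\int[phi]_(x in N) Zi i x); first exact: Zi_RN.
    by apply: null_set_integral => //; exact: measurable_funTS.
  + exact: L_Xs.
- move=> x /= nZ; have [Xx|Xx] := pselect (Xs i x); last by right.
  by left; apply: NP => /= h; apply: nZ; exact: h.
Qed.

Lemma Z_boundE dir i : Z_bound dir i =
  (lambda i)%:E * (if dir then ess_sup (L i) (Zi i) else ess_inf (L i) (Zi i)).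
Proof.
rewrite /Z_bound; case: dir.
  by rewrite -ess_sup_pZl//; apply: eq_ess_sup; exact: Z_Zi.
by rewrite -ess_inf_pZl//; apply: eq_ess_inf; exact: Z_Zi.
Qed.

(** [lambda^b M^(b-1) = lambda (lambda M)^(b-1)], where [lambda M] is the essential bound of [Z]
    itself. *)
Lemma conditional_term dir i b :
  (lambda i `^ b)%:E * epow (if dir then ess_sup (L i) (Zi i) else ess_inf (L i) (Zi i)) (b - 1) =
  (lambda i)%:E * epow (Z_bound dir i) (b - 1).
Proof.
have bnd := Z_bound_range dir i.
have E0 : 0 <= if dir then ess_sup (L i) (Zi i) else ess_inf (L i) (Zi i).
  have : 0 <= Z_bound dir i by case: (dir) bnd => /= [/ltW|/andP[]].
  by rewrite Z_boundE pmule_rge0 ?lte_fin.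
rewrite Z_boundE epowM_gt0// muleA -EFinM; congr (_%:E * _).
by rewrite -{2}(powRr1 (ltW (lambda_gt0 i))) -powRD ?subrKC// (gt_eqF (lambda_gt0 i)) implybT.
Qed.

End conditional_densities.

(** * Points whose past stays in [Z = 0] *)

Lemma outer_pastC_null (psi : {measure set (future S) -> \bar R}) Q :
  psi [set x | Z x = 0] = 0 -> H psi (Q `&` ~` pos_past) = 0.
Proof.
move=> psi0; apply/eqP; rewrite eq_le future_outer_ge0 andbT -psi0.
apply: (le_trans _ (future_outer_le_measure psi measurable_Z0)).
by apply: le_future_outer => x [_]; exact: pos_pastC_sub.
Qed.

(** The convention [0 ^ 0 = 1] separates the cases: a positive power vanishes on this set, the power
    0 charges it as [phi] does. *)
Lemma power_Z0 r : (0 < r)%R \/ phi [set x | Z x = 0] = 0 ->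
  power_measure r [set x | Z x = 0] = 0.
Proof.
move=> r0; rewrite [LHS](_ : _ = \int[phi]_(x in [set x | Z x = 0]) (Z x `^ r))//.
case: r0 => [r0|phi0].
  by apply: integral0_eq => x ->; rewrite poweR0r// gt_eqF.
apply: null_set_integral => //; first exact: measurable_Z0.
by apply: measurable_funTS; exact: meas_poweR.
Qed.

Lemma mixed_measureE a b t (t0 : (0 <= t)%R) A : measF A ->
  mixed_measure a b t0 A = power_measure a A + t%:E * power_measure b A.
Proof.
move=> mA; rewrite [LHS](_ : _ = \int[phi]_(x in A) mixed a b 1 t x)//.
by rewrite mixedE// mul1e.
Qed.

(** A covering remains one when each [B n] is cut down to [Z = 0], because these backward orbits
    never leave [Z = 0]; there [Z^b] adds nothing to [Z^0]. *)
Lemma mixed_outer_pastC0 b t (t0 : (0 <= t)%R) Q : (0 < b)%R ->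
  H (power_measure 0) (Q `&` ~` pos_past) = 0 ->
  H (mixed_measure 0 b t0) (Q `&` ~` pos_past) = 0.
Proof.
move=> b0 Q0; apply/eqP; rewrite eq_le future_outer_ge0 andbT.
apply/lee_addgt0Pr => e e0; rewrite add0e.
have [|B [mB QB] /ltW sumB] := @future_outer_lt _ _ _ S (power_measure 0) (Q `&` ~` pos_past) e%:E.
  by rewrite Q0 lte_fin.
pose C n := B n `&` [set x | Z x = 0].
have mC n : measF (C n) by apply: measurableI => //; exact: measurable_Z0.
apply: le_trans sumB.
apply: (@le_trans _ _ (\sum_(n <oo) mixed_measure 0 b t0 (C n))).
  apply: future_outer_le_cover; split=> // x [Qx Vx].
  have [n _ [y By yx]] := QB x (conj Qx Vx); exists n => //; exists y => //.
  split => //; apply/eqP; rewrite eq_le Z_ge0 andbT leNgt; apply/negP => Zy.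
  by apply: Vx; exists n => //; exists y.
apply: lee_nneseries => [n _ _|n _]; first exact: measure_ge0.
rewrite mixed_measureE// (@subset_measure0 _ _ _ (power_measure b) (C n) [set x | Z x = 0]).
- by rewrite mule0 adde0; apply: le_measure; rewrite ?inE// => x [].
- exact: mC.
- exact: measurable_Z0.
- by move=> x [].
- by apply: power_Z0; left.
Qed.

(** * Finiteness of the mass of powers of [Z] *)

Lemma power_measureT_le r s : (0 <= r <= s)%R ->
  power_measure s setT < +oo -> power_measure r setT < +oo.
Proof.
move=> /andP[r0 rs] fin; have s0 := le_trans r0 rs.
apply: (@le_lt_trans _ _ (\int[phi]_x (1 + Z x `^ s))).
  rewrite [leLHS](_ : _ = \int[phi]_x (Z x `^ r))//.
  apply: ge0_le_integral => //.
  - by move=> x _; exact: poweR_ge0.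
  - exact: meas_poweR.
  - by apply: emeasurable_funD => //; exact: meas_poweR.
  - move=> x _; have := Z_ge0 x; case: (Z x) => [z| |]// z0; last first.
      have [r_eq0|rn0] := eqVneq r 0%R; first by rewrite r_eq0 poweRe0 leeDl// poweR_ge0.
      rewrite !poweRyr// ?leey//.
      by rewrite gt_eqF// (lt_le_trans _ rs)// lt_neqAle eq_sym rn0.
    rewrite !poweR_EFin -EFinD lee_fin; rewrite lee_fin in z0.
    have [z1|z1] := leP z 1%R; last first.
      by rewrite ler_wpDl// ler_powR// ltW.
    apply: ler_wpDr; first exact: powR_ge0.
    have [z_eq0|zn0] := eqVneq z 0%R.
      have [->|rn0] := eqVneq r 0%R; first by rewrite powRr0.
      by rewrite z_eq0 powR0.
    by rewrite -(powRr0 z) ger_powR// z1 lt_neqAle eq_sym zn0 z0.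
rewrite ge0_integralD//; last 2 first.
- by move=> x _; exact: poweR_ge0.
- exact: meas_poweR.
apply: lte_add_pinfty => //.
rewrite (integral_cst phi measurableT 1) mul1e ltey_eq fin_num_measure//.
Qed.

Lemma power_measure1 : power_measure 1 setT < +oo.
Proof.
rewrite [X in X < _](_ : _ = \int[phi]_x (Z x `^ 1))//.
under eq_integral do rewrite poweRe1//.
by rewrite -Z_RN// LambdaT ltry.
Qed.

Lemma power_measure_le1 r : (0 <= r <= 1)%R -> power_measure r setT < +oo.
Proof. by move=> r01; apply: power_measureT_le power_measure1. Qed.

Let poweR_pred (x : \bar R) (b : R) : 0 <= x -> (1 <= b)%R ->
  x `^ b = x `^ (b - 1) * x.
Proof.
move=> x0 b1; have b0 : (0 < b)%R by rewrite (lt_le_trans _ b1).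
case: x x0 => [x| |]// x0.
  by rewrite !poweR_EFin -EFinM mulrC mulr_powRB1.
rewrite poweRyr ?gt_eqF//; have [->|bn1] := eqVneq b 1%R.
  by rewrite subrr poweRe0 mul1e.
by rewrite poweRyr ?mulyy// subr_eq0.
Qed.

(** The moments in [gamma_exp] are integrals against [Lambda]; as [Z] is its density,
    [Z^(b-1) dLambda] becomes [Z^b dphi]. *)
Lemma power_measure_moment (L0 : {finite_measure set (future S) -> \bar R}) b :
  L0 `<< phi -> (forall A, measF A -> L0 A = \int[phi]_(x in A) Z x) ->
  (1 <= b)%R -> \int[L0]_x (Z x `^ (b - 1)) < +oo ->
  power_measure b setT < +oo.
Proof.
move=> dom L0E b1; pose g := Radon_Nikodym_SigmaFinite.f L0 phi.
have g0 := Radon_Nikodym_SigmaFinite.f_ge0 dom.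
have gi := Radon_Nikodym_SigmaFinite.f_integrable dom.
have mg : meas_funF g by exact: (measurable_int phi).
have gZ : ae_eq phi setT g Z.
  apply: integral_ae_eq => // A _ mA.
  by rewrite -L0E// -(Radon_Nikodym_SigmaFinite.f_integral dom).
rewrite -(Radon_Nikodym_SigmaFinite.change_of_variables dom (f := fun x => Z x `^ (b - 1)))//; last 2 first.
- by move=> x; exact: poweR_ge0.
- exact: meas_poweR.
rewrite [X in _ -> X < _](_ : _ = \int[phi]_x (Z x `^ b))//.
rewrite (@ge0_ae_eq_integral _ _ _ phi setT _ (fun x => Z x `^ b))//.
- by apply: emeasurable_funM => //; exact: meas_poweR.
- exact: meas_poweR.
- by move=> x _; rewrite mule_ge0// ?poweR_ge0//; exact: g0.
- by move=> x _; exact: poweR_ge0.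
- case: gZ => N [mN N0 NP]; exists N; split => //.
  apply: subset_trans NP => x /= h h'; apply: h => xT.
  by rewrite (poweR_pred (Z_ge0 x) b1) -/g h'.
Qed.

Lemma power_measure_null N b : (0 < b)%R -> measF N -> Lambda N = 0 ->
  power_measure b N = 0.
Proof.
move=> b0 mN N0; rewrite [LHS](_ : _ = \int[phi]_(x in N) (Z x `^ b))//.
have mZN : measurable_fun (N : set (future S)) Z by exact: measurable_funTS.
have : \int[phi]_(x in N) `|Z x| = 0.
  by under eq_integral do rewrite gee0_abs//; rewrite -Z_RN.
move=> /(ae_eq_integral_abs phi mN mZN) [M [mM M0 MP]].
rewrite (@ae_eq_integral _ _ _ phi N (cst 0)) ?integral0//.
  by apply: measurable_funTS; exact: meas_poweR.
exists M; split => //; apply: subset_trans MP => x /= h h'; apply: h => Nx.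
by rewrite h'// poweR0r// gt_eqF.
Qed.

(** On [Xs i], up to a set null for [L i], [Z^b] is at most [Z] times the power [b - 1] of its
    essential supremum, so the series bounds the mass. The remainder is null for [Lambda], and
    [Z = 0] almost everywhere on it. *)
Lemma power_measure_esssup b : (1 <= b)%R ->
  \esum_(i in [set: I]) ((lambda i)%:E * epow (Z_bound true i) (b - 1)) < +oo ->
  power_measure b setT < +oo.
Proof.
move=> b1; apply: le_lt_trans; have b0 : (0 < b)%R by rewrite (lt_le_trans _ b1).
pose k i := epow (Z_bound true i) (b - 1).
have k0 i : 0 <= k i by exact: epow_ge0.
pose C i := Xs i `\` [set x | k i * Z x < Z x `^ b].
have mW i : measF [set x | k i * Z x < Z x `^ b].
  rewrite -[X in measF X]setTI; apply: measurable_lte => //; last exact: meas_poweR.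
  exact: measurable_funeM.
have mC i : measF (C i) by exact: measurableD.
have LC i : L i (~` C i) = 0.
  rewrite /C setDE setCI setCK; apply: null_set_setU; last 2 first.
  - exact: L_Xs.
  - apply: subset_measure0 (Z_bound_good true i).
    + by apply: future_two_sided.
    + apply: future_two_sided.
      have -> : [set x | ~ [/\ 0 < Z x, Z x < +oo & range_side true (Z_bound true i) (Z x)]] =
          ~` ([set x | 0 < Z x] `&` [set x | Z x < +oo] `&` [set x | Z x <= Z_bound true i]).
        by apply/seteqP; split=> x /= h h'; apply: h; move: h'; [case=> [[]]|case].
      apply: measurableC; apply: measurableI.
        by apply: measurableI; [exact: mZlt|exact: mZgt].
      by rewrite -[X in measF X]setTI; apply: measurable_lee.
    + move=> x /= kx [Z0 Zy ZE]; move: kx; apply/negP; rewrite -leNgt.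
      move: Z0 Zy ZE; case: (Z x) => [z| |]//; rewrite lte_fin => z0 _ zE.
      rewrite poweR_pred ?lee_fin ?(ltW z0)//; apply: lee_wpmul2r.
        by rewrite lee_fin ltW.
      rewrite -(@epowE R z%:E (b - 1)) ?subr_ge0//.
      by apply: epow_le; rewrite ?lee_fin ?subr_ge0// ltW.
  - by apply: measurableC; exact: future_two_sided.
  - exact: future_two_sided.
have powC i : power_measure b (C i) <= (lambda i)%:E * k i.
  apply: (@le_trans _ _ (k i * Lambda (C i))).
    rewrite [leLHS](_ : _ = \int[phi]_(x in C i) (Z x `^ b))// Z_RN// -ge0_integralZl//.
    - apply: ge0_le_integral => //.
      + by move=> x _; exact: poweR_ge0.
      + by apply: measurable_funTS; exact: meas_poweR.
      + by apply: measurable_funTS; exact: measurable_funeM.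
      + by move=> x [_ /negP]; rewrite -leNgt.
    - exact: measurable_funTS.
  rewrite muleC; apply: lee_wpmul2r => //.
  rewrite (@Lambda_Xs i); [|exact: future_two_sided|by move=> x []].
  rewrite -[leRHS]mule1; apply: lee_wpmul2l; first by rewrite lee_fin ltW.
  by apply: probability_le1; exact: future_two_sided.
pose D n := oapp C set0 (pickle_inv n).
have mD n : measF (D n) by rewrite /D; case: pickle_inv => [i|]; [exact: mC|exact: measurable0].
pose N := ~` (\bigcup_n D n).
have mN : measF N by apply: measurableC; exact: bigcupT_measurable.
have N0 : Lambda N = 0.
  rewrite L_dec; last exact: future_two_sided.
  rewrite esum1// => i _.
  rewrite (@subset_measure0 _ _ _ (L i) N (~` C i)) ?mule0//.
  - exact: future_two_sided.
  - by apply: measurableC; exact: future_two_sided.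
  - by move=> x Nx Cx; apply: Nx; exists (pickle i) => //; rewrite /D pickleK_inv.
  - exact: LC.
apply: (@le_trans _ _ (power_measure b (N `|` \bigcup_n D n))).
  by rewrite /N setUC setUv.
apply: (le_trans (measureU2 (power_measure b) _ _)) => //.
  exact: bigcupT_measurable.
rewrite [X in X + _](power_measure_null b0 mN N0) add0e.
apply: (@le_trans _ _ (\sum_(n <oo) power_measure b (D n))).
  apply: measure_sigma_subadditive => //; exact: bigcupT_measurable.
rewrite -nneseries_pickle_inv; last first.
  by move=> i; apply: mule_ge0; [rewrite lee_fin ltW|exact: k0].
apply: lee_nneseries => [n _ _|n _]; first exact: measure_ge0.
rewrite /D; case: pickle_inv => [i|]; first exact: powC.
by have -> : power_measure b (oapp C set0 None) = 0 by exact: measure0.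
Qed.

(** For [0 < x < 1] the value at [x] is at most [G 0 Q + x], the error being summed against a mass
    at most 1. Continuity carries the bound to 0, where the part of [Q] in [pos_past] already costs
    [G 0 Q]; additivity leaves nothing for the rest. *)
Lemma outer0_pastC Q : measB Q -> Hmeas_continuous0 phi Z Q ->
  H (power_measure 0) (Q `&` ~` pos_past) = 0.
Proof.
move=> mQ cont; have bE := Z_bound_range true.
have good := Z_bound_good true.
have near i z0 (_ : (0 < z0)%R) := @Z_bound_near true i z0.
pose G r Q := \esum_(i in [set: I]) ((lambda i)%:E * epow (Z_bound true i) (r - 1) * L i Q).
have fin0 : power_measure 0 setT < +oo by apply: power_measure_le1; rewrite lexx ler01.
have side0 : exponent_side true (0 - 1 : R) by rewrite /exponent_side sub0r ltrN10.
have mP := measurable_pos_past.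
have G0le : G 0%R Q <= H (power_measure 0) (Q `&` pos_past).
  have := le_Hmeas bE good side0 (measurableI _ _ mQ mP).
  rewrite HmeasE; apply: le_trans; apply: le_esum => i _.
  by rewrite L_pos_past.
have LT : \esum_(i in [set: I]) ((lambda i)%:E * L i Q) <= 1.
  by rewrite -L_dec// -LambdaT; apply: le_measure; rewrite ?inE.
have Hx x : (0 < x < 1)%R -> Hmeas phi Z x Q <= G 0%R Q + x%:E.
  move=> /andP[x0 x1].
  have sidex : exponent_side true (x - 1) by rewrite /exponent_side subr_lt0.
  have finx : power_measure x setT < +oo by apply: power_measure_le1; rewrite !ltW.
  have nullx : H (power_measure x) (Q `&` ~` pos_past) = 0.
    by apply: outer_pastC_null; apply: power_Z0; left.
  apply: (le_trans (Hmeas_le bE good near x sidex finx mQ nullx)).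
  apply: (@le_trans _ _ (G 0%R Q + x%:E * \esum_(i in [set: I]) ((lambda i)%:E * L i Q))).
    rewrite -esumZl; [|exact: ltW|by move=> i; exact: lambdaL_ge0].
    rewrite /G -esumD; last 2 first.
    - by move=> i _; rewrite !mule_ge0 ?lee_fin ?epow_ge0// ltW.
    - by move=> i _; rewrite mule_ge0 ?lee_fin ?lambdaL_ge0 ?(ltW x0).
    apply: le_esum => i _.
    apply: (@le_trans _ _ ((lambda i)%:E * (epow (Z_bound true i) (0 - 1) + x%:E) * L i Q)).
      apply: lee_wpmul2r => //; apply: lee_wpmul2l; first by rewrite lee_fin ltW.
      by apply: epow_pred_le; [exact: bE|rewrite x0].
    rewrite ge0_muleDr ?ge0_muleDl ?mule_ge0 ?lee_fin ?epow_ge0 ?(ltW (lambda_gt0 i)) ?(ltW x0)//.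
    by rewrite !muleA (muleC x%:E).
  rewrite leeD2l// -[leRHS]mule1; apply: lee_wpmul2l => //.
  by rewrite lee_fin ltW.
have H0le : Hmeas phi Z 0 Q <= G 0%R Q.
  apply/lee_addgt0Pr => e e0.
  have cvg0 : Hmeas phi Z x Q @[x --> 0%R^'+] --> Hmeas phi Z 0 Q.
    apply: cvg_trans cont; apply: cvg_app => A nA.
    have nA1 : nbhs (0%R : R) [set x : R | [set` `[0%R, 1%R]] x -> A x] by exact: nA.
    have nA2 : nbhs (0%R : R) [set x : R | (0 < x)%R -> [set` `[0%R, 1%R]] x -> A x].
      by apply: filterS nA1 => x h _.
    have nA' : \forall x \near (0%R : R)^'+, [set` `[0%R, 1%R]] x -> A x by exact: nA2.
    near=> x; suff : [set` `[0%R, 1%R]] x by near: x.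
    by rewrite /= in_itv/=; apply/andP; split; near: x; [exact: nbhs_right_ge|exact: nbhs_right_le].
  rewrite -(cvg_lim _ cvg0)//; apply: lime_le; first by apply/cvg_ex; eexists; exact: cvg0.
  near=> x; apply: (@le_trans _ _ (G 0%R Q + x%:E)).
    by apply: Hx; apply/andP; split; near: x; [exact: nbhs_right_gt|exact: nbhs_right_lt].
  by rewrite leeD2l// lee_fin; near: x; exact: nbhs_right_le.
have := le_trans H0le G0le; rewrite HmeasE (future_outerID S_bij fin0 mQ mP).
have : H (power_measure 0) (Q `&` pos_past) \is a fin_num by exact: future_outer_fin_num.
have : 0 <= H (power_measure 0) (Q `&` ~` pos_past) by exact: future_outer_ge0.
move: (H _ (Q `&` pos_past)) (H _ (Q `&` ~` pos_past)) => h1 h2.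
case: h1 => [h1| |]//; case: h2 => [h2| |]//; rewrite -EFinD !lee_fin => h20 _ le12.
by congr (_%:E); apply/eqP; rewrite eq_le h20 andbT -(lerD2l h1) addr0.
Unshelve. all: by end_near. Qed.

(** * Values of the constrained infimum *)

Section conclusions.
Context (Zi : I -> X -> \bar R) (mZi : forall i, meas_funF (Zi i)).
Context (Zi_RN : forall i A, measF A -> L i A = \int[phi]_(x in A) Zi i x).

Local Notation bound dir i :=
  (if dir then ess_sup (L i) (Zi i) else ess_inf (L i) (Zi i)).

Let sum_bound dir b Q :
  \esum_(i in [set: I]) ((lambda i `^ b)%:E * epow (bound dir i) (b - 1) * L i Q) =
  \esum_(i in [set: I]) ((lambda i)%:E * epow (Z_bound dir i) (b - 1) * L i Q).
Proof. by apply: eq_esum => i _; rewrite conditional_term. Qed.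

Let null_pow a Q : measB Q ->
  [\/ (0 < a)%R, phi [set x | Z x = 0] = 0 | a = 0%R /\ Hmeas_continuous0 phi Z Q] ->
  H (power_measure a) (Q `&` ~` pos_past) = 0.
Proof.
move=> mQ [a0|phi0|[-> cont]].
- by apply: outer_pastC_null; apply: power_Z0; left.
- by apply: outer_pastC_null; apply: power_Z0; right.
- exact: outer0_pastC.
Qed.

Lemma Hmeas2_value dir a b Q : exponent_side dir (a - 1) -> measB Q ->
  power_measure a setT < +oo -> power_measure b setT < +oo ->
  [\/ (0 < a)%R, phi [set x | Z x = 0] = 0 | a = 0%R /\ Hmeas_continuous0 phi Z Q] ->
  (0 < b)%R \/ phi [set x | Z x = 0] = 0 ->
  Hmeas2 phi Z b a Q = \esum_(i in [set: I])
    ((lambda i `^ b)%:E * epow (bound dir i) (b - 1) * L i Q).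
Proof.
move=> side mQ fa fb a0 b0; rewrite sum_bound.
apply: (Hmeas2_formula (Z_bound_range dir) (Z_bound_good dir)) => //.
- by move=> i z0 _; exact: Z_bound_near.
- exact: null_pow.
- move=> t t0 _.
  (* Either neither power charges [Z = 0], or [a = 0] and continuity at 0 takes over. *)
  have [a0'|[aE cont]] : ((0 < a)%R \/ phi [set x | Z x = 0] = 0) \/
      a = 0%R /\ Hmeas_continuous0 phi Z Q.
    by case: a0 => [?|?|?]; [left; left|left; right|right].
    apply: outer_pastC_null; rewrite mixed_measureE; last exact: measurable_Z0.
    by rewrite !power_Z0// mule0 adde0.
  case: b0 => [b0|phi0].
    by rewrite aE; apply: mixed_outer_pastC0 => //; exact: outer0_pastC.
  apply: outer_pastC_null; rewrite mixed_measureE; last exact: measurable_Z0.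
  by rewrite !power_Z0 ?mule0 ?adde0//; right.
Qed.

(** Rests on the lower half of the duality, which covers the case of infinite mass of [Z^b]. *)
Lemma Hmeas2_infinite dir a b : exponent_side dir (a - 1) ->
  power_measure a setT < +oo ->
  [\/ (0 < a)%R, phi [set x | Z x = 0] = 0 | a = 0%R /\ Hmeas_continuous0 phi Z setT] ->
  \esum_(i in [set: I]) ((lambda i `^ b)%:E * epow (bound dir i) (b - 1)) = +oo ->
  Hmeas2 phi Z b a [set: X] = +oo.
Proof.
move=> side fa a0 sum_y; apply/eqP; rewrite -leye_eq -sum_y.
have -> : \esum_(i in [set: I]) ((lambda i `^ b)%:E * epow (bound dir i) (b - 1)) =
    \esum_(i in [set: I]) ((lambda i)%:E * epow (Z_bound dir i) (b - 1) * L i setT).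
  apply: eq_esum => i _; rewrite (conditional_term mZi Zi_RN) -[LHS]mule1; congr (_ * _).
  by apply/esym; exact: probability_setT.
apply: (le_Hmeas2 (Z_bound_range dir) (Z_bound_good dir)) => //.
- by move=> i z0 _; exact: Z_bound_near.
- exact: null_pow.
Qed.

End conclusions.

End main.

(** * Divergence of truncated sums *)

Lemma limf_esup_eqy (R : realType) (f : R -> \bar R) (F : set_system R) V C :
  F V -> (forall x, V x -> f x <= C) -> limf_esup f F = +oo -> C = +oo.
Proof.
move=> FV fC fy; apply/eqP; rewrite -leye_eq -fy.
apply: (@le_trans _ _ (ereal_sup (f @` V))).
  by apply: ereal_inf_lbound; exists V.
by apply: ge_ereal_sup => _ [x Vx <-]; exact: fC.
Qed.

Section truncated_sums.
Context (R : realType) (I : countType) (lambda : I -> R) (E : I -> \bar R).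
Context (lambda_gt0 : forall i, (0 < lambda i)%R) (E_ge0 : forall i, 0 <= E i).

Local Notation total b :=
  (\esum_(i in [set: I]) ((lambda i)%:E * epow (E i) (b - 1))).

Let term_ge0 b i : 0 <= (lambda i)%:E * epow (E i) (b - 1).
Proof. by rewrite mule_ge0 ?epow_ge0// lee_fin ltW. Qed.

Lemma esum_sub_le (A : set I) (a : I -> \bar R) : (forall i, 0 <= a i) ->
  \esum_(i in A) a i <= \esum_(i in [set: I]) a i.
Proof.
by move=> a0; rewrite esum_mkcond; apply: le_esum => i _; case: ifP.
Qed.

(** Markov's inequality for the weights [lambda i]. *)
Lemma mul_esum_le_total (A : set I) (c b : R) : (0 <= c)%R ->
  (forall i, A i -> c%:E <= epow (E i) (b - 1)) ->
  c%:E * (\esum_(i in A) (lambda i)%:E) <= total b.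
Proof.
move=> c0 cA; rewrite esum_mkcond -esumZl//; last first.
  by move=> i; case: ifP => // _; rewrite lee_fin ltW.
apply: le_esum => i _; case: ifPn => [iA|_]; last by rewrite mule0.
by rewrite muleC; apply: lee_wpmul2l; [rewrite lee_fin ltW|apply: cA; rewrite -inE].
Qed.

(** Where [E i > L], the factor [L^(b-1)] is at most the power of [E i]; so each of the two
    truncated sums is at most the full one, whatever [L > 0]. *)
Lemma truncated_sup_diverges b : (1 <= b)%R ->
  limf_esup (fun L : R =>
      \esum_(i in [set i | E i <= L%:E]) ((lambda i)%:E * epow (E i) (b - 1))
      + (L `^ (b - 1))%:E * \esum_(i in [set i | L%:E < E i]) (lambda i)%:E)
    (pinfty_nbhs R) = +oo ->
  total b = +oo.
Proof.
move=> b1 lim_y; have : total b + total b = +oo.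
  apply: (limf_esup_eqy (V := [set L | 0 < L]%R) _ _ lim_y).
    by exists 0%R; split => //; exact: num_real.
  move=> L /= L0; apply: leeD; first exact: esum_sub_le.
  apply: mul_esum_le_total; first exact: powR_ge0.
  move=> i /= LE; rewrite -epow_fin//.
  by apply: epow_le; rewrite ?lee_fin ?subr_ge0// ltW.
case: (total b) (esum_ge0 (fun i (_ : setT i) => term_ge0 b i)) => [r| |]//.
Qed.

Lemma truncated_inf_diverges b : (b <= 1)%R ->
  limf_esup (fun h : R => ((h^-1)%R `^ (1 - b))%:E *
      \esum_(i in [set i | E i < h%:E]) (lambda i)%:E) (0%R^'+) = +oo ->
  total b = +oo.
Proof.
move=> b1; apply: (@limf_esup_eqy _ _ _ [set h | 0 < h]%R).
  exact: nbhs_right_gt.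
move=> h /= h0; apply: mul_esum_le_total; first exact: powR_ge0.
move=> i /= Eh; have -> : (h^-1 `^ (1 - b) = h `^ (b - 1))%R.
  by rewrite -powR_inv1 ?ltW// -powRrM mulN1r opprB.
by rewrite -epow_fin//; apply: epow_ge; rewrite ?subr_le0// ltW.
Qed.

End truncated_sums.

(** * The formulas in terms of the critical exponents *)

Unset Implicit Arguments.
Set Strict Implicit.

Theorem theorem12 (R : realType) (d : measure_display) (X : measurableType d)
  (S : X -> X) (S_bij : bijective S)
  (phi0 : {finite_measure set (future S) -> \bar R})
  (Lambda0 : {finite_measure set (future S) -> \bar R})
  (Lambda0_inv : @invariant_measure _ (future S) R S Lambda0)
  (Lambda0_ac : Lambda0 `<< phi0)
  (Z : X -> \bar R) (Z_ge0 : forall x, 0 <= Z x)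
  (Z_RN : @RN_version _ (future S) R Lambda0 phi0 Z)
  (* Lambda is the S-invariant extension of Lambda0 *)
  (Lambda : {measure set (two_sided S) -> \bar R})
  (Lambda_inv : @invariant_measure _ (two_sided S) R S Lambda)
  (Lambda_ext : forall A : set X,
     @measurable _ (future S) A -> Lambda A = Lambda0 A)
  (Lambda_1 : Lambda [set: X] = 1)
  (* the ergodic decomposition *)
  (I : countType) (lambda : I -> R) (Lambda_ : I -> probability (two_sided S) R)
  (lambda_01 : forall i, (0 < lambda i <= 1)%R)
  (Lambda_erg : forall i, @ergodic_measure _ (two_sided S) R S (Lambda_ i))
  (Lambda_distinct : forall i j, i <> j ->
     exists2 A : set (two_sided S), measurable A & Lambda_ i A <> Lambda_ j A)
  (Lambda_dec : forall A : set (two_sided S), measurable A ->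
     Lambda A = \esum_(i in [set: I]) ((lambda i)%:E * Lambda_ i A))
  (Z_ : I -> X -> \bar R)
  (Z__RN : forall i, @RN_version _ (future S) R (Lambda_ i) phi0 (Z_ i))
  (Q : set X) (Q_meas : @measurable _ (two_sided S) Q) :
  let m i := ess_inf (Lambda_ i) (Z_ i) in
  let M i := ess_sup (Lambda_ i) (Z_ i) in
  let alphaE := alpha_exp lambda m in
  let betaE := beta_exp lambda M in
  let gammaE := @gamma_exp R _ (future S) Lambda0 Z in
  (* (a)(i) *)
  (forall alpha : R,
     (0 < alpha < 1)%R \/ (alpha = 0%R /\ Hmeas_continuous0 phi0 Z Q) ->
   forall beta : R,
     [\/ (0 < beta <= 1)%R,
         (1 < beta)%R /\ beta%:E < betaE
       | beta = 0%R /\ phi0 `<< Lambda0] ->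
     Hmeas2 phi0 Z beta alpha Q =
     \esum_(i in [set: I])
       ((lambda i `^ beta)%:E * epow (M i) (beta - 1) * Lambda_ i Q)) /\
  (* (a)(ii) *)
  (forall alpha : R,
     (0 < alpha < 1)%R \/ (alpha = 0%R /\ Hmeas_continuous0 phi0 Z [set: X]) ->
   forall beta : R,
     betaE <= beta%:E -> beta%:E < gammaE ->
     limf_esup (fun L : R =>
         \esum_(i in [set i | (lambda i)%:E * M i <= L%:E])
           ((lambda i `^ beta)%:E * epow (M i) (beta - 1))
         + (L `^ (beta - 1))%:E *
           \esum_(i in [set i | L%:E < (lambda i)%:E * M i]) (lambda i)%:E)
       (pinfty_nbhs R) = +oo ->
     Hmeas2 phi0 Z beta alpha [set: X] = +oo) /\
  (* (b) *)
  (forall alpha : R, (1 < alpha)%R -> alpha%:E < gammaE ->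
     (* (i) *)
     (forall beta : R,
        ((0 < beta)%R /\ beta%:E <= alphaE) \/
        (beta = 0%R /\ phi0 `<< Lambda0) ->
        limf_esup (fun delta : R =>
            ((delta^-1)%R `^ (1 - beta))%:E *
            \esum_(i in [set i | (lambda i)%:E * m i < delta%:E])
              (lambda i)%:E)
          (0%R^'+) = +oo ->
        Hmeas2 phi0 Z beta alpha [set: X] = +oo) /\
     (* (ii) *)
     (forall beta : R, alphaE < beta%:E -> beta%:E < gammaE ->
        Hmeas2 phi0 Z beta alpha Q =
        \esum_(i in [set: I])
          ((lambda i `^ beta)%:E * epow (m i) (beta - 1) * Lambda_ i Q))).
Proof.
move=> m M alphaE betaE gammaE.
have lambda_gt0 i : (0 < lambda i)%R by have /andP[] := lambda_01 i.
have [mZ Z_int] := Z_RN.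
have Z_RN' (A : set X) : @measurable _ (future S) A -> Lambda A = \int[phi0]_(x in A) Z x.
  by move=> mA; rewrite Lambda_ext// Z_int.
have mZi i := (Z__RN i).1.
have Zi_RN i (A : set X) (mA : @measurable _ (future S) A) := (Z__RN i).2 A mA.
have [Xs [mXs L_Xs L_Xs0 Xs_disj]] :=
  ergodic_family_separation S_bij Lambda_erg Lambda_distinct.
have value := @Hmeas2_value _ _ _ _ S_bij _ _ Lambda_inv Lambda_1 _ Z_ge0 mZ Z_RN'
  _ _ _ lambda_gt0 Lambda_erg Lambda_dec _ mXs L_Xs L_Xs0 Xs_disj _ mZi Zi_RN.
have infinite := @Hmeas2_infinite _ _ _ _ S_bij _ _ Lambda_inv Lambda_1 _ Z_ge0 mZ Z_RN'
  _ _ _ lambda_gt0 Lambda_erg Lambda_dec _ mXs L_Xs L_Xs0 Xs_disj _ mZi Zi_RN.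
have le1 := power_measure_le1 Lambda_1 Z_ge0 mZ Z_RN'.
have term := @conditional_term _ _ _ _ _ _ Lambda_1 _ Z_ge0 mZ Z_RN' _ _ _
  lambda_gt0 Lambda_dec _ mXs L_Xs L_Xs0 _ mZi Zi_RN.
have boundE := Z_boundE Lambda_1 mZ Z_RN' lambda_gt0 Lambda_dec mXs L_Xs L_Xs0 mZi Zi_RN.
have bound_ge0 dir i : 0 <= Z_bound Z Lambda_ dir i.
  have := Z_bound_range Lambda_1 Z_ge0 mZ Z_RN' lambda_gt0 Lambda_dec dir i.
  by case: dir => /= [/ltW|/andP[]].
have phiZ0 : phi0 `<< Lambda0 -> phi0 [set x | Z x = 0] = 0.
  have mZ0 := measurable_Z0 Z_ge0 mZ.
  move=> /null_content_dominatesP; apply; first exact: mZ0.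
  by apply: etrans (Z_int _ mZ0) _; exact: integral0_eq.
(* The supremum need not be attained: an admissible [b > r] is chosen, and finiteness descends from
   [b] to [r]. *)
have gamma_fin r : (0 <= r)%R -> r%:E < gammaE -> power_measure phi0 mZ r setT < +oo.
  move=> r0 /ereal_sup_gt[_ [b [b1 bfin] <-]]; rewrite lte_fin => rb.
  apply: (@power_measureT_le _ _ _ _ _ _ Z_ge0 mZ r b); first by rewrite r0 ltW.
  exact: (power_measure_moment Z_ge0 mZ Lambda0_ac Z_int b1 bfin).
have beta_fin r : (0 <= r)%R -> r%:E < betaE -> power_measure phi0 mZ r setT < +oo.
  move=> r0 /ereal_sup_gt[_ [b [b1 bfin] <-]]; rewrite lte_fin => rb.
  apply: (@power_measureT_le _ _ _ _ _ _ Z_ge0 mZ r b); first by rewrite r0 ltW.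
  apply: (power_measure_esssup Lambda_1 Z_ge0 mZ Z_RN' lambda_gt0 Lambda_dec mXs L_Xs L_Xs0 b1).
  by under eq_esum do rewrite -term.
have sum1 : \esum_(i in [set: I]) (lambda i)%:E = 1.
  rewrite -Lambda_1 (Lambda_dec _ (@measurableT _ (two_sided S))); apply: eq_esum => i _.
  by rewrite -[LHS]mule1; congr (_ * _); apply/esym; exact: probability_setT.
(* At exponent 1 the series is the total mass 1, so 1 belongs to both sets defining the exponents,
   whence [alphaE <= 1 <= betaE]. *)
have sum_exp1 (E : I -> \bar R) :
    \esum_(i in [set: I]) ((lambda i `^ 1)%:E * epow (E i) (1 - 1)) < +oo.
  under eq_esum do rewrite subrr epow0 mule1 powRr1 ?(ltW (lambda_gt0 _))//.
  by rewrite sum1 ltry.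
have alphaE_le1 : alphaE <= 1.
  by apply: ereal_inf_lbound; exists 1%R => //; split; rewrite ?ltr01 ?lexx//; exact: sum_exp1.
have alphaE_ge0 : 0 <= alphaE.
  by apply: le_ereal_inf_tmp => _ [b [/andP[b0 _] _] <-]; rewrite lee_fin ltW.
have betaE_ge1 : 1 <= betaE.
  by apply: ereal_sup_ubound; exists 1%R => //; split; rewrite ?lexx//; exact: sum_exp1.
have alpha_null alpha (P : Prop) : (0 < alpha < 1)%R \/ (alpha = 0%R /\ P) ->
  [/\ exponent_side true (alpha - 1), power_measure phi0 mZ alpha setT < +oo &
    [\/ (0 < alpha)%R, phi0 [set x | Z x = 0] = 0 | alpha = 0%R /\ P]].
  move=> [/andP[a0 a1]|[-> p]]; split.
  - by rewrite /exponent_side subr_lt0.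
  - by apply: le1; rewrite !ltW.
  - exact: Or31.
  - by rewrite /exponent_side sub0r ltrN10.
  - by apply: le1; rewrite lexx ler01.
  - exact: Or33.
split; [|split].
- move=> alpha /alpha_null[side fa a0] beta bcase.
  have b0 : (0 <= beta)%R.
    by case: bcase => [/andP[/ltW]|[/ltW/(le_trans ler01)]|[->]].
  apply: (value true) => //.
    case: bcase => [/andP[_ b1]|[_ bE]|[-> _]]; [|exact: beta_fin|].
      by apply: le1; rewrite b0.
    by apply: le1; rewrite lexx ler01.
  case: bcase => [/andP[? _]|[b1 _]|[_ /phiZ0]]; [by left| |by right].
  by left; rewrite (lt_trans ltr01).
- move=> alpha /alpha_null[side fa a0] beta bE _ lim_y.
  apply: (infinite true) => //.
  have b1 : (1 <= beta)%R by rewrite -lee_fin (le_trans betaE_ge1).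
  under eq_esum do rewrite (term true).
  apply: truncated_sup_diverges => //.
  rewrite -lim_y; congr (limf_esup _ _); apply/funext => L.
  (* The truncation by [lambda_i M_i] is thus one by the essential bound of [Z]. *)
  have BE i : Z_bound Z Lambda_ true i = (lambda i)%:E * M i by exact: boundE.
  congr (_ + _ * _).
    under [in RHS]eq_esum do rewrite (term true).
    by congr (esum _ _); apply/funext => i; rewrite /mkset BE.
  by congr (esum _ _); apply/funext => i; rewrite /mkset BE.
- move=> alpha a1 aE.
  have a0 : (0 < alpha)%R by rewrite (lt_trans ltr01).
  have side : exponent_side false (alpha - 1) by rewrite /exponent_side subr_gt0.
  have fa := gamma_fin _ (ltW a0) aE.
  have BE i : Z_bound Z Lambda_ false i = (lambda i)%:E * m i by exact: boundE.
  split=> [beta bcase lim_y|beta aEb bE].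
    apply: (infinite false) => //; first exact: Or31.
    have b1 : (beta <= 1)%R.
      by case: bcase => [[_ bE]|[-> _]]; rewrite ?ler01// -lee_fin (le_trans bE).
    under eq_esum do rewrite (term false).
    apply: truncated_inf_diverges => //.
    rewrite -lim_y; congr (limf_esup _ _); apply/funext => h; congr (_ * _).
    by congr (esum _ _); apply/funext => i; rewrite /mkset BE.
  have b0 : (0 < beta)%R by rewrite -lte_fin (le_lt_trans alphaE_ge0).
  apply: (value false) => //; [exact: gamma_fin (ltW b0) bE|exact: Or31|by left].
Qed.
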